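(* For $n\ge 4$, the chromatic homology groups of the complete graph $K_n$ with $n$ vertices are given, as graded $\mathbb{Z}$-modules (up to isomorphism), by $$H^i(K_n)\cong\begin{cases}\mathbb{Z}\{n\} & i=0,\\ H^{i-1}(K_{n-1})^{\oplus(n-2)}\oplus H^i(K_{n-1})\{1\} & 1\le i\le n-2,\\ 0 & i\ge n-1.\end{cases}$$
   Context: Chromatic homology (over $\mathbb{Z}[x]/(x^2)$). Let $G=(V(G),E(G))$ be a finite graph with vertices $1,\dots,N$, its edges $\{a,b\}$, $a<b$, ordered lexicographically. For $s\subset E(G)$ let $[G:s]=(V(G),s)$. An enhanced state of $G$ is a pair $S=(s,c)$, where $s\subset E(G)$ and $c$ assigns to each connected component of $[G:s]$ a color $1$ or $x$. Put $i(S)=\#s$ and $j(S)=$ the number of components colored $x$. $C^{i,j}(G)$ is the free $\mathbb{Z}$-module on the enhanced states with $i(S)=i$, $j(S)=j$ (zero if $i<0$ or $j<0$). The differential $\partial_G^{i,j}:C^{i,j}(G)\to C^{i+1,j}(G)$ is $\partial_G^{i,j}(S)=\sum_{f\in E(G)\setminus s}(-1)^{n(f)}S_f$, where $n(f)$ is the number of edges of $s$ ordered before $f$, and $S_f$ has edge set $s\cup\{f\}$ and the following coloring: if $f$ joins two different components $E_a,E_b$ of $[G:s]$, the merged component gets the color $c(E_a)c(E_b)$ computed in $\mathbb{Z}[x]/(x^2)$ (so $1\cdot1=1$, $1\cdot x=x\cdot 1=x$, and $S_f:=0$ if both colors are $x$), and the other colors are unchanged; if both ends of $f$ lie in the same component,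 all colors are unchanged. Then $H^{i,j}(G)=\ker\partial_G^{i,j}/\operatorname{im}\partial_G^{i-1,j}$, and $H^i(G)=\bigoplus_{j\ge0}H^{i,j}(G)$ is a $\mathbb{Z}$-module graded by $j$. Grading shift. For a graded $\mathbb{Z}$-module $M=\bigoplus_j M_j$, $M\{l\}$ is the graded module with $M\{l\}_j=M_{j-l}$ (all degrees increased by $l$). $\mathbb{Z}$ without shift is placed in degree $0$, so $\mathbb{Z}\{n\}$ is $\mathbb{Z}$ in degree $n$. *)

(* Defs.v *)
(* boolp serves only to make membership in the image of a differential a
   boolean predicate, as needed to form the quotient. *)
From HB Require Import structures.
From mathcomp Require Import all_boot all_order all_algebra boolp.

Set Implicit Arguments.
Unset Strict Implicit.
Unset Printing Implicit Defensive.

Import Order.TTheory GRing.Theory Num.Theory.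
Local Open Scope ring_scope.

(** * Graphs *)

(* An edge {a, b} with a < b is encoded as the pair (a, b). *)
Definition edge (N : nat) := ('I_N * 'I_N)%type.

Record graph (N : nat) := Graph {
  edges : {set edge N};
  edges_lt : [forall e in edges, (e.1 < e.2)%N]
}.

Definition edge_lexlt N (e f : edge N) : bool :=
  (e.1 < f.1)%N || ((e.1 == f.1) && (e.2 < f.2)%N).

Lemma complete_edges_lt N :
  [forall e in [set e : edge N | (e.1 < e.2)%N], (e.1 < e.2)%N].
Proof. by apply/forall_inP => e; rewrite inE. Qed.

Definition complete_graph N : graph N := Graph (complete_edges_lt N).

(** * Enhanced states *)

Section States.
Variable N : nat.
Implicit Types (s : {set edge N}) (f : edge N).

Definition adj s : rel 'I_N := fun a b => ((a, b) \in s) || ((b, a) \in s).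

Definition components s : {set {set 'I_N}} :=
  [set [set w | connect (adj s) v w] | v : 'I_N].

Definition component s := {A : {set 'I_N} | A \in components s}.

Lemma component_of_subproof s v :
  [set w | connect (adj s) v w] \in components s.
Proof. exact: imset_f. Qed.

Definition component_of s (v : 'I_N) : component s :=
  exist _ [set w | connect (adj s) v w] (component_of_subproof s v).

(* A color is the exponent of x: false is the color 1, true is the color x. *)
Definition color := bool.

(* Product of colors in Z[x]/(x^2); None stands for x * x = 0. *)
Definition color_mul (c d : color) : option color :=
  if c && d then None else Some (c || d).

Definition enhanced_state : finType :=
  {s : {set edge N} & {ffun component s -> color}}.

Definition state (s : {set edge N}) (c : {ffun component s -> color}) :
  enhanced_state := Tagged (fun s => {ffun component s -> color}) c.

Definition ideg (S : enhanced_state) : nat := #|tag S|.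

Definition jdeg (S : enhanced_state) : nat := #|[set A : component (tag S) | tagged S A]|.

(* The coloring of [G : s + f] that agrees with c off the component of the
   first end of f, and gives that component the color m.  A component of
   [G : s + f] not meeting f is a component of [G : s], so the default value
   of insubd is irrelevant. *)
Definition recolor s (c : {ffun component s -> color}) f (m : color) :
    {ffun component (f |: s) -> color} :=
  [ffun A : component (f |: s) =>
     if f.1 \in val A then m
     else c (insubd (component_of s f.1) (val A))].

(* S_f, with None for S_f = 0.  When both ends of f lie in the same component
   the recoloring gives this component its old color. *)
Definition add_edge (S : enhanced_state) f : option enhanced_state :=
  let: existT s c := S in
  let Ea := component_of s f.1 in
  let Eb := component_of s f.2 in
  if Ea == Eb then Some (state (recolor c f (c Ea)))
  else if color_mul (c Ea) (c Eb) is Some m then Some (state (recolor c f m))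
  else None.

End States.

(** * Chain complex and homology *)

Section Homology.
Variables (N : nat) (G : graph N).

Definition basis (i : nat) (j : int) : finType :=
  {S : enhanced_state N |
    [&& tag S \subset edges G, ideg S == i & (jdeg S)%:Z == j]}.

Definition chain (i : nat) (j : int) : zmodType := {ffun basis i j -> int}.

(* The basis vector of a state, extended by 0 at None. *)
Definition gen i j (o : option (enhanced_state N)) : chain i j :=
  [ffun T => (o == Some (val T))%:R].

Definition nbefore (S : enhanced_state N) (f : edge N) : nat :=
  #|[set e in tag S | edge_lexlt e f]|.

Definition diff_state i j (S : basis i j) : chain i.+1 j :=
  \sum_(f in edges G :\: tag (val S))
    gen i.+1 j (add_edge (val S) f) *~ ((-1) ^+ nbefore (val S) f).

Definition diff i j (u : chain i j) : chain i.+1 j :=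
  \sum_S diff_state S *~ u S.

Lemma diff_is_zmod_morphism i j : zmod_morphism (@diff i j).
Proof.
move=> u v; rewrite /diff -sumrB; apply: eq_bigr => S _.
by rewrite !ffunE mulrzBr.
Qed.

HB.instance Definition _ i j :=
  GRing.isZmodMorphism.Build _ _ (@diff i j) (@diff_is_zmod_morphism i j).

Definition cycles i j : {pred chain i j} := [pred u | diff u == 0].

Lemma cycles_zmod_closed i j : zmod_closed (@cycles i j).
Proof.
split=> [|u v]; rewrite !inE ?raddf0 //.
by move=> /eqP du /eqP dv; rewrite raddfB /= du dv subr0.
Qed.

HB.instance Definition _ i j :=
  GRing.isZmodClosed.Build _ (@cycles i j) (@cycles_zmod_closed i j).

Record ker_diff i j := Cycle {
  cycle_chain : chain i j;
  cycle_chainP : cycle_chain \in @cycles i j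
}.

HB.instance Definition _ i j := [isSub for @cycle_chain i j].
HB.instance Definition _ i j := [Choice of ker_diff i j by <:].
HB.instance Definition _ i j :=
  [SubChoice_isSubZmodule of ker_diff i j by <:].

(* In degree 0 the incoming differential starts from C^{-1,j} = 0. *)
Definition is_boundary i j : chain i j -> Prop :=
  match i with
  | 0%N => fun u => u = 0
  | i'.+1 => fun u => exists v : chain i' j, u = diff v
  end.

Definition boundaries i j : {pred ker_diff i j} :=
  [pred u | `[< is_boundary (cycle_chain u) >]].

Lemma boundaries_zmod_closed i j : zmod_closed (@boundaries i j).
Proof.
split=> [|u v]; rewrite !inE /=.
  by apply/asboolP; case: (i) => [|i'] //=; exists 0; rewrite raddf0.
move=> /asboolP Bu /asboolP Bv; apply/asboolP.
case: (i) (cycle_chain u) (cycle_chain v) Bu Bv => [|i'] x y /=.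
  by move=> -> ->; rewrite subr0.
by move=> [a ->] [b ->]; exists (a - b); rewrite raddfB.
Qed.

HB.instance Definition _ i j :=
  GRing.isZmodClosed.Build _ (@boundaries i j) (@boundaries_zmod_closed i j).

(* The image of the incoming differential is restricted to ker_diff, so the
   identity diff (diff u) = 0 is not needed to form the quotient. *)
Definition homology (i : nat) (j : int) : zmodType :=
  Quotient.quot (@boundaries i j).

End Homology.

(** * Graded Z-modules *)

Definition graded_zmod := int -> zmodType.

(* Z-modules are the same as abelian groups, and Z-linear maps the same as
   additive maps. *)
Definition graded_iso (M P : graded_zmod) : Prop :=
  forall j, exists f : {additive M j -> P j}, bijective f.

Definition graded_shift (M : graded_zmod) (l : int) : graded_zmod :=
  fun j => M (j - l).

Definition graded_sum (M P : graded_zmod) : graded_zmod :=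
  fun j => (M j * P j)%type.

Definition graded_power (M : graded_zmod) (k : nat) : graded_zmod :=
  fun j => {ffun 'I_k -> M j}.

(* 'rV[int]_0 is the trivial group. *)
Definition graded_zero : graded_zmod := fun=> 'rV[int]_0.

Definition graded_Z : graded_zmod :=
  fun j => if j == 0 then (int : zmodType) else ('rV[int]_0 : zmodType).

Definition chromatic_homology N (G : graph N) (i : nat) : graded_zmod :=
  fun j => homology G i j.

(* Main.v *)
(* Let R be Z[x_1, ..., x_N]/(x_1^2, ..., x_N^2).  The summand of C(G) at an
   edge set s is R/I_s, where I_s is generated by the x_a - x_b with {a, b} in
   s, and the differential is the signed sum of the quotient maps.  So chains
   are represented by families of elements of R, and equalities hold modulo the
   ideals I_s.

   For an edge f, removing f from s is a contraction of the family-level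
   complex.  Composed with multiplication by x_a + x_b for f = {a, b}, it
   respects the ideals, because (x_a + x_b)(x_a - x_b) = 0; hence x_a + x_b is
   null-homotopic on C(G), and so is x_a - x_b as soon as a and b have a common
   neighbour.

   Now view K_n as a star vertex 0 joined to K_{n-1}, and split a chain into
   rows indexed by the set t of spokes.  The rows with #t >= 2 form an acyclic
   subcomplex, and the remaining quotient is the cone of
     C(K_{n-1}) (x) Z[x_0]/(x_0^2) -> C(K_{n-1})^{n-1},
     u + x_0 v |-> (u + x_a v)_a.
   Cancelling u against the diagonal leaves the cone of
   (x_a - x_1)_a : C(K_{n-1}){1} -> C(K_{n-1})^{n-2}, which splits for n >= 4
   because these maps are null-homotopic. *)

From HB Require Import structures.
Require Import Defs.
From mathcomp Require Import all_boot all_order all_algebra boolp.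

Set Implicit Arguments.
Unset Strict Implicit.
Unset Printing Implicit Defensive.

Import Order.TTheory GRing.Theory Num.Theory.
Local Open Scope ring_scope.

(** * Cochains on the cube of edge sets *)

Lemma edge_lexlt_total N (e f : edge N) : e != f -> edge_lexlt e f = ~~ edge_lexlt f e.
Proof.
case: e f => [a b] [c d]; rewrite /edge_lexlt -pair_eqE /= negb_and -!val_eqE /=.
by case: (ltngtP a c) => //=; case: (ltngtP b d).
Qed.

Section Cube.
Variables (N : nat) (V : zmodType).
Implicit Types (s : {set edge N}) (f g : edge N) (z w : {set edge N} -> V).

Definition nbelow s f := #|[set e in s | edge_lexlt e f]|.

(** Read [z] as the element of the exterior algebra on all pairs with coefficient [z s] at the
    ordered product of [s]. Then [cobd] is left multiplication by the sum of all pairs, and [htpy f]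
    is contraction with the dual of [f]. The graph can stay implicit, because removing edges never
    leaves its edge set. *)
Definition cobd z s : V := \sum_(f in s) z (s :\ f) *~ (-1) ^+ nbelow s f.

Definition htpy f z s : V :=
  if f \in s then 0 else z (f |: s) *~ (-1) ^+ nbelow s f.

Lemma edge_lexltxx f : edge_lexlt f f = false.
Proof. by rewrite /edge_lexlt !ltnn andbF. Qed.

Lemma nbelowD1 s f g : nbelow s f = ((g \in s) && edge_lexlt g f + nbelow (s :\ g) f)%N.
Proof.
rewrite /nbelow (cardsD1 g) inE; congr (_ + #|pred_of_set _|)%N.
by apply/setP=> e; rewrite !inE andbA.
Qed.

Lemma nbelowD1id s f : nbelow (s :\ f) f = nbelow s f.
Proof. by rewrite (nbelowD1 s f f) edge_lexltxx andbF. Qed.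

(** Exactly one of [f] and [g] precedes the other, so exactly one of the two counts changes when
    inserting [f] and removing [g] are interchanged. *)
Lemma nbelow_swap s f g : f \notin s -> g \in s ->
  (-1) ^+ nbelow (f |: s) g * (-1) ^+ nbelow s f =
  - ((-1) ^+ nbelow (s :\ g) f * (-1) ^+ nbelow s g) :> int.
Proof.
move=> fs gs; have nfg : f != g by apply: contraNneq fs => ->.
rewrite (nbelowD1 _ g f) setU11 setU1K // (nbelowD1 s f g) gs /=.
rewrite (edge_lexlt_total nfg) !exprD.
move: ((-1) ^+ nbelow s g) ((-1) ^+ nbelow (s :\ g) f) => u v.
by case: edge_lexlt; rewrite ?expr0 ?expr1 ?mulN1r !mul1r ?mulrN ?mulNr (mulrC u).
Qed.

Lemma cobd_ext z w s : (forall f, f \in s -> z (s :\ f) = w (s :\ f)) -> cobd z s = cobd w s.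
Proof. by move=> zw; apply: eq_bigr => f /zw ->. Qed.

Lemma cobd0 z s : (forall t, z t = 0) -> cobd z s = 0.
Proof. by move=> z0; rewrite /cobd big1 // => f _; rewrite z0 mul0rz. Qed.

(** This is the Leibniz rule for a contraction with value 1 on the sum of all pairs. For [f] outside
    [s], the terms that remove some [g] in [s] cancel in pairs by [nbelow_swap]. *)
Lemma htpyE f z s : cobd (htpy f z) s + htpy f (cobd z) s = z s.
Proof.
rewrite /htpy; have [fs|fs] := boolP (f \in s).
  rewrite addr0 /cobd (bigD1 f) //= setD11 setD1K // big1 ?addr0.
    by rewrite nbelowD1id -mulrzA -expr2 sqrr_sign mulr1z.
  by move=> g /andP[gs nfg]; rewrite !inE eq_sym nfg fs mul0rz.
rewrite /cobd big_setU1 //= setU1K // mulrzDl addrCA -mulrzA.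
rewrite {1}(nbelowD1 _ f f) edge_lexltxx andbF setU1K // -expr2 sqrr_sign mulr1z.
rewrite -[RHS]addr0; congr (_ + _); rewrite mulrz_suml -big_split /= big1 // => g gs.
have nfg : f != g by apply: contraNneq fs => ->.
rewrite !inE (negPf fs) andbF -!mulrzA nbelow_swap //.
have -> : (f |: s) :\ g = f |: (s :\ g).
  by apply/setP=> e; rewrite !inE; case: eqP => [->|]; rewrite ?(eq_sym g) ?(negPf nfg) //=.
by rewrite mulrNz subrr.
Qed.

Lemma cobdB z w s : cobd (fun t => z t - w t) s = cobd z s - cobd w s.
Proof. by rewrite -sumrB; apply: eq_bigr => f _; rewrite mulrzBl. Qed.

Lemma cobdD z w s : cobd (fun t => z t + w t) s = cobd z s + cobd w s.
Proof. by rewrite -big_split; apply: eq_bigr => f _; rewrite mulrzDl. Qed.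

Lemma cobdN z s : cobd (fun t => - z t) s = - cobd z s.
Proof. by rewrite -sumrN; apply: eq_bigr => f _; rewrite mulNrz. Qed.

Lemma htpyB f z w s : htpy f (fun t => z t - w t) s = htpy f z s - htpy f w s.
Proof. by rewrite /htpy; case: ifP; rewrite ?subr0 ?mulrzBl. Qed.

(* Conjugating [cobd \o cobd] by the contraction [htpy f] removes the edge [f]. *)
Lemma cobdK z s : cobd (cobd z) s = 0.
Proof.
elim: {s}_.+1 {-2}s z (ltnSn #|s|) => // n IH s z; rewrite ltnS => sn.
have [->|[f fs]] := set_0Vmem s; first by rewrite /cobd big_set0.
rewrite -(setD1K fs); set s' := s :\ f.
have fs' : f \notin s' by rewrite setD11.
have s'n : (#|s'| < n)%N by rewrite (leq_trans _ sn) // (cardsD1 f s) fs.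
have := htpyE f (cobd z) s'; rewrite {2}/htpy (negPf fs').
rewrite (@cobd_ext _ (fun t => z t - cobd (htpy f z) t)); last first.
  by move=> g _; rewrite -(htpyE f z) addrAC subrr add0r.
rewrite cobdB IH // subr0 => /(canRL (addKr _)); rewrite addNr.
by move/(congr1 (fun v => v *~ (-1) ^+ nbelow s' f)); rewrite mul0rz -mulrzA -expr2 sqrr_sign.
Qed.
End Cube.

Lemma cobd_comp N (U V : zmodType) (M : {additive U -> V}) (z : {set edge N} -> U) s :
  cobd (fun t => M (z t)) s = M (cobd z s).
Proof. by rewrite raddf_sum; apply: eq_bigr => f _; rewrite raddfMz. Qed.

(** * The squarefree polynomial ring and the ideals of edge sets *)

Section Monomials.
Variable N : nat.
Implicit Types (s t : {set edge N}) (T : {set 'I_N}) (a b : 'I_N).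

(* Z[x_a : a < N]/(x_a^2), as functions on squarefree monomials. *)
Definition sqfree := {ffun {set 'I_N} -> int}.
Implicit Types u v : sqfree.

Definition mulX a u : sqfree := [ffun T : {set 'I_N} => if a \in T then u (T :\ a) else 0].

Lemma mulX_is_zmod_morphism a : zmod_morphism (mulX a).
Proof. by move=> u v; apply/ffunP=> T; rewrite !ffunE; case: ifP; rewrite ?subr0. Qed.

HB.instance Definition _ a :=
  GRing.isZmodMorphism.Build _ _ (mulX a) (mulX_is_zmod_morphism a).

Definition part (j : int) u : sqfree := [ffun T : {set 'I_N} => if #|T|%:Z == j then u T else 0].

Lemma part_is_zmod_morphism j : zmod_morphism (part j).
Proof. by move=> u v; apply/ffunP=> T; rewrite !ffunE; case: ifP; rewrite ?subr0. Qed.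

HB.instance Definition _ j :=
  GRing.isZmodMorphism.Build _ _ (part j) (part_is_zmod_morphism j).

Lemma mulXX a u : mulX a (mulX a u) = 0.
Proof. by apply/ffunP=> T; rewrite !ffunE setD11; case: ifP. Qed.

Lemma mulXC a b u : mulX a (mulX b u) = mulX b (mulX a u).
Proof.
have [->//|nab] := eqVneq a b.
apply/ffunP=> T; rewrite !ffunE !inE nab eq_sym nab /=.
by case: (a \in T); case: (b \in T); rewrite // setDDl setUC -setDDl.
Qed.

Lemma part_mulX j a u : part j (mulX a u) = mulX a (part (j - 1) u).
Proof.
apply/ffunP=> T; rewrite !ffunE; case: (boolP (a \in T)) => aT; last by rewrite if_same.
by rewrite (cardsD1 a T) aT PoszD -(inj_eq (addIr (- 1%:Z))) addrAC subrr add0r.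
Qed.

(* [sqfree / ideal s] is the summand of C(G) at the edge set [s]. *)
Inductive ideal s : sqfree -> Prop :=
| Ideal0 : ideal s 0
| IdealB u v : ideal s u -> ideal s v -> ideal s (u - v)
| IdealX e u : e \in s -> ideal s (mulX e.1 u - mulX e.2 u).

Lemma idealN s u : ideal s u -> ideal s (- u).
Proof. by rewrite -sub0r; apply: IdealB; apply: Ideal0. Qed.

Lemma idealD s u v : ideal s u -> ideal s v -> ideal s (u + v).
Proof. by rewrite -[v in u + v]opprK => su sv; apply: IdealB => //; apply: idealN. Qed.

Lemma idealMz s u k : ideal s u -> ideal s (u *~ k).
Proof.
move=> su; have suMn n : ideal s (u *+ n).
  by elim: n => [|n IH]; rewrite ?mulr0n ?mulrS; [apply: Ideal0|apply: idealD].
by case: k => n; rewrite ?NegzE ?mulrNz -pmulrn //; apply: idealN.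
Qed.

Lemma ideal_sum s (I : Type) (r : seq I) (P : pred I) (F : I -> sqfree) :
  (forall i, P i -> ideal s (F i)) -> ideal s (\sum_(i <- r | P i) F i).
Proof. by move=> sF; apply: big_ind => //; [apply: Ideal0|apply: idealD]. Qed.

Lemma ideal_sub s t u : s \subset t -> ideal s u -> ideal t u.
Proof.
move=> /subsetP st; elim=> [|{}u v _ Qu _ Qv|e {}u /st es].
- exact: Ideal0.
- exact: IdealB.
- exact: IdealX.
Qed.

Lemma ideal_mulX s a u : ideal s u -> ideal s (mulX a u).
Proof.
elim=> [|{}u v _ Qu _ Qv|e {}u es]; rewrite ?raddf0 ?raddfB; first exact: Ideal0.
  exact: IdealB.
by rewrite /= !(mulXC a); apply: IdealX.
Qed.

Lemma ideal_set0 u : ideal set0 u -> u = 0.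
Proof. by elim=> // [{}u v _ -> _ ->|e {}u]; rewrite ?subrr ?inE. Qed.

(* [x_a + x_b] annihilates [x_a - x_b]. *)
Lemma ideal_addX s e u : ideal (e |: s) u -> ideal s (mulX e.1 u + mulX e.2 u).
Proof.
elim=> [|{}u v _ Qu _ Qv|g {}u]; first by rewrite !raddf0 addr0; apply: Ideal0.
  by rewrite !raddfB addrACA -opprD; apply: IdealB.
case/setU1P=> [->|gs]; last by apply: idealD; apply: ideal_mulX; apply: IdealX.
rewrite !raddfB /= !mulXX (mulXC e.2 e.1) sub0r subr0 addNr; exact: Ideal0.
Qed.

End Monomials.

(** * Evaluation of monomials at enhanced states, with the ideals as kernels *)

Section Evaluation.
Variable N : nat.
Implicit Types (s : {set edge N}) (T : {set 'I_N}) (a b v w : 'I_N).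
Implicit Types (S : enhanced_state N) (f : edge N).

Lemma adj_connect_sym s : connect_sym (adj s).
Proof. by apply: sym_connect_sym => a b; rewrite /adj orbC. Qed.

Lemma component_of_eq s v w :
  (component_of s v == component_of s w) = connect (adj s) v w.
Proof.
apply/eqP/idP => [/(congr1 val)/= /setP/(_ w)|vw]; first by rewrite !inE connect0.
by apply: val_inj; apply/setP=> x; rewrite !inE (same_connect (@adj_connect_sym s) vw).
Qed.

Lemma componentP s (A : component s) : exists v, A = component_of s v.
Proof. by have /imsetP[v _ eA] := valP A; exists v; apply: val_inj. Qed.

Lemma mem_component_of s v w : (w \in val (component_of s v)) = connect (adj s) v w.
Proof. by rewrite inE. Qed.

Lemma connect_adjU1 s f v w :
  connect (adj (f |: s)) v w =
  [|| connect (adj s) v w,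
      connect (adj s) v f.1 && connect (adj s) f.2 w |
      connect (adj s) v f.2 && connect (adj s) f.1 w].
Proof.
have sub : subrel (connect (adj s)) (connect (adj (f |: s))).
  apply: connect_sub => x y xy; apply: connect1.
  by move: xy; rewrite /adj !inE => /orP[]->; rewrite !orbT.
have f12 : connect (adj (f |: s)) f.1 f.2.
  by apply: connect1; rewrite /adj -surjective_pairing setU11.
apply/idP/idP; last first.
  case/or3P=> [/sub //|/andP[/sub va /sub bw]|/andP[/sub vb /sub aw]].
    exact: connect_trans va (connect_trans f12 bw).
  by apply: connect_trans vb (connect_trans _ aw); rewrite adj_connect_sym.
case/connectP=> p; elim: p v => [|x p IH] v /=; first by move=> _ ->; rewrite connect0.
case/andP=> vx /IH{}IH /IH.
have [/connect1 vx'|nvx] := boolP (adj s v x).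
  case/or3P=> [/(connect_trans vx')->//|/andP[]|/andP[]];
    by move=> /(connect_trans vx')-> ->; rewrite ?orbT.
move: nvx vx; rewrite /adj !inE => /norP[/negPf-> /negPf->]; rewrite !orbF.
case/orP=> /eqP <-; rewrite /= !connect0 /=.
  by case/or3P=> [->|/andP[_ ->]|->]; rewrite ?orbT.
by case/or3P=> [->|->|/andP[_ ->]]; rewrite ?orbT.
Qed.

(** Two variables in one component both become its x, so a product containing them is 0 in C(G);
    this condition excludes that. *)
Definition separated s T :=
  [forall a in T, forall b in T, connect (adj s) a b ==> (a == b)].

Lemma separatedP s T :
  reflect {in T &, forall a b, connect (adj s) a b -> a = b} (separated s T).
Proof.
apply: (iffP forall_inP) => [sT a b aT bT ab|sT a aT].
  by have /forall_inP/(_ b bT)/implyP/(_ ab)/eqP := sT a aT.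
by apply/forall_inP=> b bT; apply/implyP=> /(sT a b aT bT)/eqP.
Qed.

Definition hit s T : {ffun component s -> color} :=
  [ffun A : component s => [exists w in T, w \in val A]].

(* The image in C(G) of the monomial prod_(a in T) x_a; None stands for 0. *)
Definition mono_state s T : option (enhanced_state N) :=
  if separated s T then Some (state (hit s T)) else None.

Lemma hit_component_of s T v : hit s T (component_of s v) = [exists w in T, connect (adj s) v w].
Proof. by rewrite ffunE; apply: eq_existsb => w; rewrite mem_component_of. Qed.

Lemma hit_recolor s T f :
  recolor (hit s T) f (hit s T (component_of s f.1) || hit s T (component_of s f.2)) =
  hit (f |: s) T.
Proof.
apply/ffunP=> A; have [v ->] := componentP A; rewrite hit_component_of ffunE mem_component_of.
case: ifP => [va|nva]; rewrite ?hit_component_of.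
  apply/orP/exists_inP => [[]/exists_inP[w wT cw]|[w wT cw]].
  - exists w => //; apply: connect_trans va _; by rewrite connect_adjU1 cw.
  - exists w => //; apply: connect_trans va _; by rewrite connect_adjU1 connect0 cw orbT.
  have: connect (adj (f |: s)) f.1 w by apply: connect_trans cw; rewrite adj_connect_sym.
  rewrite connect_adjU1 => /or3P[c1|/andP[_ c1]|/andP[_ c1]].
  - by left; apply/exists_inP; exists w.
  - by right; apply/exists_inP; exists w.
  - by left; apply/exists_inP; exists w.
have eqc w : connect (adj (f |: s)) v w = connect (adj s) v w.
  move: nva; rewrite !connect_adjU1 connect0 andbT => /norP[/negPf nva].
  by rewrite negb_or => /andP[_ /negPf nvb]; rewrite nva nvb /= orbF.
(* A component that misses [f] is already a component of [s], so [insubd] returns it and not its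
   default. *)
have -> : insubd (component_of s f.1) (val (component_of (f |: s) v)) = component_of s v.
  apply: val_inj; rewrite val_insubd.
  have -> : val (component_of (f |: s) v) = val (component_of s v).
    by apply/setP=> w; rewrite !inE eqc.
  by rewrite (valP (component_of s v)).
by rewrite hit_component_of; apply: eq_existsb => w; rewrite eqc.
Qed.

(** This is why the differential is induced by the quotient maps: adding [f] kills a surviving
    monomial exactly when [f] joins two different components that both meet [T], which is the rule x
    * x = 0. *)
Lemma mono_state_add_edge s T f :
  obind (fun S => add_edge S f) (mono_state s T) = mono_state (f |: s) T.
Proof.
rewrite /mono_state; have [sT|nsT] := boolP (separated s T); last first.
  rewrite /= ifN //; apply: contra nsT => /separatedP sT; apply/separatedP=> a b aT bT ab.
  by apply: sT => //; rewrite connect_adjU1 ab.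
rewrite /= component_of_eq -hit_recolor /color_mul.
have [ab|nab] := boolP (connect (adj s) f.1 f.2).
  move: (ab); rewrite -component_of_eq => /eqP <-; rewrite orbb ifT //.
  apply/separatedP=> v w vT wT; rewrite connect_adjU1 => vw.
  have ba : connect (adj s) f.2 f.1 by rewrite adj_connect_sym.
  apply: (separatedP _ _ sT) => //; case/or3P: vw => // /andP[c1 c2].
    exact: connect_trans c1 (connect_trans ab c2).
  exact: connect_trans c1 (connect_trans ba c2).
rewrite !hit_component_of.
case: andP => [[/exists_inP[v vT av] /exists_inP[w wT bw]]|nvw].
  rewrite ifN //; apply/negP=> /separatedP sT'.
  have evw : v = w by apply: sT' => //; rewrite connect_adjU1 (adj_connect_sym s v f.1) av bw orbT.
  by move/negP: nab; apply; apply: connect_trans av _; rewrite evw adj_connect_sym.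
rewrite ifT //; apply/separatedP=> v w vT wT; rewrite connect_adjU1.
case/or3P=> [|/andP[c1 c2]|/andP[c1 c2]]; first exact: (separatedP _ _ sT v w vT wT).
- case: nvw; split; apply/exists_inP; last by exists w.
  by exists v => //; rewrite adj_connect_sym.
- case: nvw; split; apply/exists_inP; first by exists w.
  by exists v => //; rewrite adj_connect_sym.
Qed.

Lemma tag_mono_state s T S : mono_state s T = Some S -> tag S = s.
Proof. by rewrite /mono_state; case: ifP => // _ [<-]. Qed.

Lemma jdeg_mono_state s T S : mono_state s T = Some S -> jdeg S = #|T|.
Proof.
rewrite /mono_state; case: ifP => // /separatedP sT [<-] /=.
rewrite -(@card_in_imset _ _ (component_of s) (mem T)); last first.
  by move=> v w vT wT /eqP; rewrite component_of_eq; apply: sT.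
apply: eq_card => A; rewrite inE /=; have [v ->] := componentP A.
rewrite hit_component_of; apply/exists_inP/imsetP => [[w wT vw]|[w wT /eqP]].
  by exists w => //; apply/eqP; rewrite component_of_eq.
by rewrite component_of_eq; exists w.
Qed.

(** One variable for each component colored x, taken at its canonical root. This gives a section of
    [mono_state]. *)
Definition reps S : {set 'I_N} :=
  [set v | (fingraph.root (adj (tag S)) v == v) && tagged S (component_of (tag S) v)].

Lemma mono_state_reps S : mono_state (tag S) (reps S) = Some S.
Proof.
case: S => s c; rewrite /mono_state /= ifT; last first.
  apply/separatedP=> v w; rewrite !inE => /andP[/eqP rv _] /andP[/eqP rw _].
  by move/(fingraph.rootP (@adj_connect_sym s)); rewrite rv rw.
congr (Some (state _)); apply/ffunP=> A; have [v ->] := componentP A.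
rewrite hit_component_of; apply/exists_inP/idP => [[w]|cv].
  by rewrite !inE /= => /andP[_ cw]; rewrite -component_of_eq => /eqP->.
exists (fingraph.root (adj s) v); last exact: connect_root.
rewrite inE /= (root_root (@adj_connect_sym s)) eqxx /=.
by have := connect_root (adj s) v; rewrite -component_of_eq => /eqP<-.
Qed.

Implicit Types u : sqfree N.

Definition mono T : sqfree N := [ffun T' => (T' == T)%:R].

Lemma mulX_mono a T : mulX a (mono T) = if a \in T then 0 else mono (a |: T).
Proof.
apply/ffunP=> T'; rewrite !ffunE; have [aT|naT] := boolP (a \in T).
  rewrite ffunE; case: ifP => // _; case: eqP => // eT.
  by move: aT; rewrite -eT setD11.
rewrite ffunE; have [aT'|naT'] := boolP (a \in T').
  congr (nat_of_bool _)%:R; apply/eqP/eqP => [<-|->]; first by rewrite setD1K.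
  by rewrite setU1K.
by case: eqP => // eT; move: naT'; rewrite eT setU11.
Qed.

Lemma ffunMzE (aT : finType) (V : zmodType) (u : {ffun aT -> V}) k x : (u *~ k) x = u x *~ k.
Proof. by case: k => n; rewrite ?NegzE ?mulrNz ?ffunE -!pmulrn ffunMnE. Qed.

Lemma sqfree_mono u : u = \sum_T mono T *~ u T.
Proof.
apply/ffunP=> T; rewrite sum_ffunE (bigD1 T) //= big1 => [|T' nT].
  by rewrite addr0 ffunMzE ffunE eqxx intz.
by rewrite ffunMzE ffunE eq_sym (negPf nT) mul0rz.
Qed.

(* The coefficient at [S] of the image of [u] in C(G). *)
Definition coef s S u := \sum_(T | mono_state s T == Some S) u T.

Lemma coef_is_zmod_morphism s S : zmod_morphism (coef s S).
Proof. by move=> u v; rewrite -sumrB; apply: eq_bigr => T _; rewrite !ffunE. Qed.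

HB.instance Definition _ s S :=
  GRing.isZmodMorphism.Build _ _ (coef s S) (coef_is_zmod_morphism s S).

Lemma coef_mono s S T : coef s S (mono T) = (mono_state s T == Some S)%:R.
Proof.
rewrite /coef; have [eS|neS] := boolP (mono_state s T == Some S).
  rewrite (bigD1 T) //= big1 => [|T' /andP[_ nT]]; first by rewrite ffunE eqxx addr0.
  by rewrite ffunE (negPf nT).
by rewrite big1 // => T' eS; rewrite ffunE; case: (T' =P T) => // eT; rewrite -eT eS in neS.
Qed.

Lemma separatedU1 s a T : a \notin T ->
  separated s (a |: T) = separated s T && [forall w in T, ~~ connect (adj s) a w].
Proof.
move=> aT; apply/separatedP/andP => [sT|[/separatedP sT /forall_inP na] v w].
  split; first by apply/separatedP=> v w vT wT; apply: sT; rewrite !inE ?vT ?wT orbT.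
  apply/forall_inP=> w wT; apply: contra aT => aw.
  by rewrite (sT a w) // !inE ?wT ?eqxx ?orbT.
rewrite !inE => /orP[/eqP->|vT] /orP[/eqP->|wT] // vw; last exact: sT.
- by have := na _ wT; rewrite vw.
- by have := na _ vT; rewrite adj_connect_sym vw.
Qed.

(** Replacing [a] by [b] in the same component changes neither separation nor the components hit, so
    x_a and x_b act alike on states. The tests [a \in T] and [b \in T] account for products that
    vanish already in the polynomial ring. *)
Lemma mono_state_mulX s a b T : connect (adj s) a b ->
  (if a \in T then None else mono_state s (a |: T)) =
  (if b \in T then None else mono_state s (b |: T)).
Proof.
suff main a' b' : connect (adj s) a' b' -> a' \notin T ->
    mono_state s (a' |: T) = if b' \in T then None else mono_state s (b' |: T).
  move=> ab; have [aT|aT] := boolP (a \in T); last exact: main.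
  case: ifP => // /negbT bT; rewrite (main b a) ?aT //.
  by rewrite adj_connect_sym.
move=> {a b} ab aT; rewrite /mono_state separatedU1 //; have [bT|bT] := boolP (b' \in T).
  by rewrite ifN //; apply/negP=> /andP[_ /forall_inP/(_ _ bT)]; rewrite ab.
rewrite separatedU1 //.
have eqab w : connect (adj s) a' w = connect (adj s) b' w.
  exact: (same_connect (@adj_connect_sym s)).
under eq_forallb do rewrite eqab.
case: ifP => // _; congr (Some (state _)); apply/ffunP=> A.
have [v ->] := componentP A; rewrite !hit_component_of.
suff hU c : [exists w in c |: T, connect (adj s) v w] =
    connect (adj s) c v || [exists w in T, connect (adj s) v w] by rewrite !hU eqab.
rewrite (adj_connect_sym s c); apply/exists_inP/orP => [[w]|[vc|/exists_inP[w wT vw]]].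
- rewrite !inE => /orP[/eqP->|wT] vw; [by left|right].
  by apply/exists_inP; exists w.
- by exists c; rewrite ?setU11.
- by exists w; rewrite // !inE wT orbT.
Qed.

Lemma ideal_coef s S u : ideal s u -> coef s S u = 0.
Proof.
elim=> [|{}u v _ cu _ cv|[a b] {}u abs]; first by rewrite raddf0.
  by rewrite raddfB /= cu cv subrr.
rewrite raddfB /=; apply/eqP; rewrite subr_eq0; apply/eqP; rewrite (sqfree_mono u) !raddf_sum /=.
apply: eq_bigr => T _; rewrite !raddfMz /= !mulX_mono; congr (_ *~ _).
have := @mono_state_mulX s a b T; rewrite connect1 /adj ?abs // => /(_ isT).
by case: ifP => _; case: ifP => _ e; rewrite ?raddf0 ?coef_mono -?e // e.
Qed.

Lemma ideal_connect s a b u : connect (adj s) a b -> ideal s (mulX a u - mulX b u).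
Proof.
case/connectP=> p; elim: p a => [|c p IH] a /=.
  by move=> _ ->; rewrite subrr; apply: Ideal0.
case/andP=> ac /IH{}IH /IH cb; rewrite -(subrKA (mulX c u)); apply: idealD => //.
case/orP: ac => ac; first exact: (IdealX u ac).
by rewrite -opprB; apply/idealN/(IdealX u ac).
Qed.

Lemma foldr_mulX (l : seq 'I_N) :
  foldr (@mulX N) (mono set0) l = if uniq l then mono [set x in l] else 0.
Proof.
elim: l => [|a l IH] /=; first by congr mono; apply/setP=> x; rewrite !inE.
rewrite IH; case: ifP => ul; rewrite ?andbF ?raddf0 // andbT mulX_mono inE.
by case: (a \in l) => //; congr mono; apply/setP=> x; rewrite !inE.
Qed.

(** Modulo the ideal each variable may be replaced by the one at the root of its component. This is
    done factor by factor on an iterated product, which vanishes as soon as two roots coincide. *)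
Lemma ideal_mono s T :
  ideal s (mono T - if mono_state s T is Some S' then mono (reps S') else 0).
Proof.
pose r := fingraph.root (adj s).
have cr a : connect (adj s) a (r a) by exact: connect_root.
have rr a b : (r a == r b) = connect (adj s) a b.
  exact/root_connect/adj_connect_sym.
have -> : mono T = foldr (@mulX N) (mono set0) (enum T).
  by rewrite foldr_mulX enum_uniq; congr mono; apply/setP=> x; rewrite inE mem_enum.
have -> : (if mono_state s T is Some S' then mono (reps S') else 0) =
    foldr (@mulX N) (mono set0) (map r (enum T)).
  rewrite foldr_mulX /mono_state; have -> : uniq (map r (enum T)) = separated s T.
    rewrite -/(dinjectiveb r (mem T)); apply/dinjectiveP/separatedP => rT v w vT wT.
      by rewrite -rr => /eqP; apply: rT.
    by move/eqP; rewrite rr; apply: rT.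
  case: ifP => // /separatedP sT; congr mono; apply/setP=> v; rewrite !inE /=.
  rewrite hit_component_of; apply/andP/mapP => [[/eqP rv /exists_inP[w wT]]|[w]].
    by rewrite -rr {1}/r rv => /eqP->; exists w; rewrite ?mem_enum.
  rewrite mem_enum => wT ->; rewrite (root_root (@adj_connect_sym s)) eqxx; split=> //.
  by apply/exists_inP; exists w; rewrite // adj_connect_sym cr.
elim: (enum T) => [|a l IH] /=; first by rewrite subrr; apply: Ideal0.
rewrite -(subrKA (mulX a (foldr (@mulX N) (mono set0) (map r l)))) -raddfB /=.
by apply: idealD; [apply: ideal_mulX | apply: ideal_connect].
Qed.

(** By [ideal_mono], [u] is congruent to a combination of the monomials [reps S], and the
    coefficients of that combination are the numbers [coef s S u]. Together with [ideal_coef] this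
    identifies the quotient by [ideal s] with the free module on the states over [s]. *)
Lemma coef_ideal s u : (forall S, tag S = s -> coef s S u = 0) -> ideal s u.
Proof.
move=> cu; rewrite (sqfree_mono u).
rewrite -[X in ideal s X]subr0.
have {2}<- : \sum_T (if mono_state s T is Some S' then mono (reps S') else 0) *~ u T = 0.
  have eS T : (if mono_state s T is Some S' then mono (reps S') else 0) *~ u T =
      \sum_(S | mono_state s T == Some S) mono (reps S) *~ u T.
    case: (mono_state s T) => [S|]; last by rewrite mul0rz big1.
    by rewrite (big_pred1 S) // => S'; rewrite eq_sym.
  under eq_bigr do rewrite eS.
  rewrite (exchange_big_dep xpredT) //= big1 // => S _; rewrite -mulrz_sumr.
  have [eq_s|ns] := eqVneq (tag S) s; first by rewrite -/(coef s S u) cu ?mulr0z.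
  by rewrite big_pred0 ?mulr0z // => T; apply/eqP=> /tag_mono_state eq_s; rewrite eq_s eqxx in ns.
rewrite -sumrB; apply: ideal_sum => T _; rewrite -mulrzBl; apply: idealMz.
exact: ideal_mono.
Qed.

End Evaluation.

(** * Chains as families of polynomials *)

Section Chains.
Variables (N : nat) (G : graph N).
Implicit Types (s : {set edge N}) (z w : {set edge N} -> sqfree N).

Lemma jdeg_add_edge (S S' : enhanced_state N) f :
  add_edge S f = Some S' -> jdeg S' = jdeg S.
Proof.
move=> eS'; have := mono_state_add_edge (tag S) (reps S) f.
rewrite mono_state_reps /= eS' => /esym/jdeg_mono_state ->.
by rewrite (jdeg_mono_state (mono_state_reps S)).
Qed.

Lemma tag_add_edge (S S' : enhanced_state N) f :
  add_edge S f = Some S' -> tag S' = f |: tag S.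
Proof.
case: S => s c /=; case: ifP => _; first by case=> <-.
by case: (color_mul _ _) => // m [<-].
Qed.

Lemma coef_setU1 s f (S' : enhanced_state N) u :
  coef (f |: s) S' u = \sum_(S | (add_edge S f == Some S') && (tag S == s)) coef s S u.
Proof.
rewrite /coef (exchange_big_dep (fun T => mono_state (f |: s) T == Some S')) /=.
  apply: eq_bigr => T; rewrite -mono_state_add_edge.
  case eS: (mono_state s T) => [S0|//] /= eS'; rewrite (big_pred1 S0) // => S.
  rewrite (inj_eq Some_inj) /= [RHS]eq_sym; apply/andb_idl => /eqP <-.
  by rewrite eS' (tag_mono_state eS) eqxx.
move=> S T /andP[eS' _] /eqP eS.
by rewrite -mono_state_add_edge eS.
Qed.

Lemma coef_part s S j u : coef s S (part j u) = if (jdeg S)%:Z == j then coef s S u else 0.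
Proof.
rewrite /coef; case: ifP => jS.
  by apply: eq_bigr => T /eqP/jdeg_mono_state eT; rewrite ffunE -eT jS.
by rewrite big1 // => T /eqP/jdeg_mono_state eT; rewrite ffunE -eT jS.
Qed.

Definition chain_of i j z : chain G i j :=
  [ffun S : basis G i j => coef (tag (val S)) (val S) (z (tag (val S)))].

(** At a state S' both sides are the signed sum over all pairs (S, f) with S_f = S': [diff] runs
    over S first, and [cobd] over f first. *)
Lemma diff_chain_of i j z : diff (chain_of i j z) = chain_of i.+1 j (cobd z).
Proof.
apply/ffunP=> U; set S' := val U; rewrite ffunE -/S' /cobd raddf_sum /=.
have /and3P[sE /eqP si /eqP Sj] := valP U; rewrite -/S' /ideg in sE si Sj.
pose F (S : enhanced_state N) f := coef (tag S) S (z (tag S)) *~ (-1) ^+ nbelow (tag S) f.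
pose P := [pred S : enhanced_state N |
  [&& tag S \subset edges G, ideg S == i & (jdeg S)%:Z == j]].
pose Q (S : enhanced_state N) f :=
  [&& f \in tag S', add_edge S f == Some S' & tag S == tag S' :\ f].
transitivity (\sum_S \sum_(f | Q S f) F S f); last first.
  rewrite (exchange_big_dep (mem (tag S'))) /=; last by move=> S f _ /andP[].
  apply: eq_bigr => f fS'; rewrite raddfMz /=.
  have -> : coef (tag S') S' = coef (f |: (tag S' :\ f)) S' by rewrite setD1K.
  rewrite coef_setU1 mulrz_suml.
  apply: eq_big => [S|S]; first by rewrite /Q fS'.
  by case/and3P=> _ _ /eqP eS; rewrite /F eS nbelowD1id.
rewrite /diff sum_ffunE.
transitivity (\sum_(S in P) \sum_(f | Q S f) F S f); last first.
  (* A state S with S_f = S' has its edges in [G], one edge fewer than S' and the same [jdeg], so it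
     belongs to the basis in degree [i]. *)
  rewrite [RHS](bigID (mem P)) /=.
  rewrite [X in _ = _ + X]big1 ?addr0 // => S nS; rewrite big_pred0 // => f.
  apply: contraNF nS => /and3P[fS' /eqP eS' /eqP eS]; rewrite inE -(jdeg_add_edge eS') Sj eqxx.
  rewrite eS (subset_trans (subD1set _ _) sE) /ideg eS -eqSS -si.
  by rewrite (cardsD1 f (tag S')) fS' eqxx.
rewrite [RHS]big_sub /=; apply: eq_bigr => S _.
rewrite ffunMzE /diff_state sum_ffunE mulrz_suml ffunE.
have /and3P[SE _ _] := valP S.
rewrite [LHS](bigID (fun f => add_edge (val S) f == Some S')) /=.
rewrite [X in _ + X]big1 ?addr0 => [|f /andP[_ nS']]; last first.
  by rewrite ffunMzE ffunE (negPf nS') !mul0rz.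
apply: eq_big => [f|f /andP[_ eS']]; last first.
  rewrite ffunMzE ffunE eS' /F /nbefore -/(nbelow _ _).
  by rewrite !mulrzz mul1r mulrC.
rewrite /Q andbA [in RHS]andbC andbA; case: eqP => [eS'|_]; rewrite ?andbF // !andbT.
have et := tag_add_edge eS'; rewrite inE et setU11 andbT.
apply/andP/eqP => [[fS _]|->]; first by rewrite setU1K.
by rewrite setD11; split=> //; apply: (subsetP sE); rewrite et setU11.
Qed.

Definition null i j z :=
  forall s, s \subset edges G -> #|s| = i -> ideal s (part j (z s)).

Lemma chain_of_eq0 i j z : chain_of i j z = 0 <-> null i j z.
Proof.
split=> [z0 s sE si|z0].
  apply: coef_ideal => S eS; rewrite coef_part; case: ifP => // jS.
  have PS : [&& tag S \subset edges G, ideg S == i & (jdeg S)%:Z == j].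
    by rewrite /ideg eS sE si jS eqxx.
  by move/ffunP/(_ (exist _ S PS)): z0; rewrite !ffunE /= eS.
apply/ffunP=> S; rewrite !ffunE; have /and3P[sE /eqP si /eqP Sj] := valP S.
by have := ideal_coef (val S) (z0 _ sE si); rewrite coef_part Sj eqxx.
Qed.

Lemma chain_of_onto i j (u : chain G i j) :
  exists z : {ffun {set edge N} -> sqfree N}, chain_of i j z = u.
Proof.
exists [ffun s => \sum_(S : basis G i j | tag (val S) == s) mono (reps (val S)) *~ u S].
apply/ffunP=> S; rewrite !ffunE raddf_sum (bigD1 S) //= raddfMz /= coef_mono.
rewrite mono_state_reps eqxx intz big1 ?addr0 // => S' /andP[/eqP eS nS].
rewrite raddfMz /= coef_mono -eS mono_state_reps (inj_eq Some_inj) (inj_eq val_inj).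
by rewrite (negPf nS) mul0rz.
Qed.

End Chains.

(** * Homology groups presented by cycles and boundaries *)

Section Presentations.

(* [H] is the group of cycles [cyc] modulo the boundaries [bnd]. *)
Definition presents (Z : zmodType) (cyc bnd : Z -> Prop) (H : zmodType) : Prop :=
  exists p : Z -> H,
    [/\ forall z w, cyc z -> cyc w -> cyc (z - w) /\ p (z - w) = p z - p w,
        forall z, cyc z -> p z = 0 <-> bnd z
      & forall h, exists2 z, cyc z & p z = h].

Definition additive_iso (H H' : zmodType) : Prop :=
  exists f : {additive H -> H'}, bijective f.

(** The induced map sends a class to the class of [phi] at a chosen cycle. That [phi] preserves
    boundaries makes it independent of the choice, and that [phi] reflects them makes it
    injective. *)
Lemma presents_iso (Z Z' : zmodType) (cyc bnd : Z -> Prop) (cyc' bnd' : Z' -> Prop)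
    (H H' : zmodType) (phi : {additive Z -> Z'}) :
  presents cyc bnd H -> presents cyc' bnd' H' ->
  (forall z, cyc z -> cyc' (phi z)) ->
  (forall z, cyc z -> bnd z <-> bnd' (phi z)) ->
  (forall z', cyc' z' -> exists2 z, cyc z & bnd' (phi z - z')) ->
  additive_iso H H'.
Proof.
move=> [p [pB p0 pS]] [p' [pB' p0' pS']] cphi bphi Sphi.
pose g h := s2val (cid2 (pS h)).
have cg h : cyc (g h) by exact: s2valP (cid2 (pS h)).
have gK h : p (g h) = h by exact: s2valP' (cid2 (pS h)).
pose f h := p' (phi (g h)).
have fE z : cyc z -> f (p z) = p' (phi z).
  move=> cz; have [cd pd] := pB _ _ (cg (p z)) cz.
  have [_ pd'] := pB' _ _ (cphi _ (cg (p z))) (cphi _ cz).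
  apply/eqP; rewrite -subr_eq0 -pd' -raddfB; apply/eqP/(p0' _ (cphi _ cd))/bphi => //.
  by apply/p0; rewrite // pd gK subrr.
have fB : zmod_morphism f.
  move=> h1 h2; have [cd pd] := pB _ _ (cg h1) (cg h2).
  rewrite -{1}(gK h1) -{1}(gK h2) -pd fE // raddfB.
  by have [_ ->] := pB' _ _ (cphi _ (cg h1)) (cphi _ (cg h2)).
have f_inj : injective f.
  move=> h1 h2 /eqP; rewrite -subr_eq0 -fB => /eqP f0; apply/eqP; rewrite -subr_eq0.
  by rewrite -(gK (h1 - h2)); apply/eqP/p0/bphi/p0'; auto.
have f_onto h' : exists h, f h = h'.
  have [z' cz' <-] := pS' h'; have [z cz bz] := Sphi z' cz'; exists (p z).
  have [cd pd] := pB' _ _ (cphi _ cz) cz'.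
  by rewrite fE //; apply/eqP; rewrite -subr_eq0 -pd; apply/eqP/p0'.
pose fA : {additive H -> H'} := HB.pack f (GRing.isZmodMorphism.Build _ _ f fB).
exists fA; exists (fun h' => sval (cid (f_onto h'))) => [h|h']; rewrite /fA /=.
  by apply: f_inj; apply: (svalP (cid (f_onto _))).
exact: (svalP (cid (f_onto _))).
Qed.

Lemma presents_prod (Z Z' : zmodType) (cyc bnd : Z -> Prop) (cyc' bnd' : Z' -> Prop)
    (H H' : zmodType) :
  presents cyc bnd H -> presents cyc' bnd' H' ->
  presents (fun z : (Z * Z')%type => cyc z.1 /\ cyc' z.2) (fun z => bnd z.1 /\ bnd' z.2)
    (H * H')%type.
Proof.
move=> [p [pB p0 pS]] [p' [pB' p0' pS']]; exists (fun z => (p z.1, p' z.2)); split.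
- move=> z w [cz cz'] [cw cw']; have [? e] := pB _ _ cz cw; have [? e'] := pB' _ _ cz' cw'.
  by split=> //=; rewrite e e'.
- move=> z [cz cz']; split=> [[/p0 ? /p0' ?]|[/p0 e /p0' e']]; first by auto.
  by rewrite e ?e'.
- move=> [h h']; have [z cz <-] := pS h; have [z' cz' <-] := pS' h'.
  by exists (z, z').
Qed.

Lemma presents_power k (Z : zmodType) (cyc bnd : Z -> Prop) (H : zmodType) :
  presents cyc bnd H ->
  presents (fun z : {ffun 'I_k -> Z} => forall a, cyc (z a)) (fun z => forall a, bnd (z a))
    {ffun 'I_k -> H}.
Proof.
move=> [p [pB p0 pS]]; exists (fun z : {ffun 'I_k -> Z} => [ffun a => p (z a)]); split.
- move=> z w cz cw; split=> [a|]; last apply/ffunP=> a; rewrite !ffunE.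
    by have [] := pB _ _ (cz a) (cw a).
  by have [] := pB _ _ (cz a) (cw a).
- move=> z cz; split=> [/ffunP e a|bz].
    by apply/p0; rewrite ?(cz a) //; have := e a; rewrite !ffunE.
  by apply/ffunP=> a; rewrite !ffunE; apply/p0.
- move=> h; pose g h := s2val (cid2 (pS h)); exists [ffun a => g (h a)].
    by move=> a; rewrite ffunE; exact: s2valP (cid2 (pS _)).
  by apply/ffunP=> a; rewrite !ffunE; exact: s2valP' (cid2 (pS _)).
Qed.

Variables (N : nat) (G : graph N).

Definition is_cycle i j (z : {set edge N} -> sqfree N) := null G i.+1 j (cobd z).

(* For [i = 0] the condition on [y] is void, since [cobd y set0 = 0]. *)
Definition is_bound i j (z : {set edge N} -> sqfree N) :=
  exists y, null G i j (fun s => z s - cobd y s).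

Lemma homology_presents i j :
  presents (fun z : {ffun {set edge N} -> sqfree N} => is_cycle i j z) (fun z => is_bound i j z)
    (homology G i j).
Proof.
pose Z := {ffun {set edge N} -> sqfree N}.
have cycE (z : {set edge N} -> sqfree N) : is_cycle i j z <-> chain_of G i j z \in @cycles N G i j.
  rewrite inE diff_chain_of; split=> [/chain_of_eq0 ->//|/eqP/chain_of_eq0//].
have chB i' (z w : Z) : chain_of G i' j (z - w) = chain_of G i' j z - chain_of G i' j w.
  by apply/ffunP=> S; rewrite !ffunE raddfB.
(* The default 0 is taken only off the cycles; on cycles [valc] recovers the chain of [z]. *)
pose c (z : Z) : ker_diff G i j := insubd 0 (chain_of G i j z).
have valc (z : Z) : is_cycle i j z -> cycle_chain (c z) = chain_of G i j z.
  by move=> /cycE cz; rewrite -[LHS]/(val (c z)) val_insubd cz.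
have piE (u : ker_diff G i j) : \pi_(homology G i j)%qT u = 0 <-> u \in @boundaries N G i j.
  by rewrite -[u in u \in _]subr0 Quotient.idealrBE -(raddf0 \pi_(homology G i j)%qT); split=> /eqP.
have cB (z w : Z) : is_cycle i j z -> is_cycle i j w ->
    is_cycle i j (z - w) /\ c (z - w) = c z - c w.
  move=> cz cw; have czw : is_cycle i j (z - w).
    apply/cycE; rewrite chB; move/cycE: cz; move/cycE: cw; rewrite !inE => /eqP ew /eqP ez.
    by rewrite raddfB /= ez ew subrr.
  split=> //; apply: val_inj; rewrite [LHS]valc // chB -valc // -valc //.
exists (fun z : Z => \pi_(homology G i j)%qT (c z)); split.
- by move=> z w cz cw; have [? ->] := cB z w cz cw; rewrite raddfB.
- move=> z cz; rewrite piE inE /= valc //.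
  split=> [/asboolP|[y /chain_of_eq0 zy]].
    case: i {c valc piE cB cycE cz} => [z0|i [v]] /=.
      exists (fun _ => 0) => s sE si; rewrite /cobd big1 => [|f _]; last by rewrite mul0rz.
      by rewrite subr0; apply: (proj1 (chain_of_eq0 _ _ _ _) z0).
    have [y <-] := chain_of_onto v; rewrite diff_chain_of => ezy.
    exists y; apply/chain_of_eq0/ffunP=> S.
    by move/ffunP/(_ S): ezy; rewrite !ffunE raddfB /= => ->; rewrite subrr.
  apply/asboolP; case: i y zy {c valc piE cB cycE cz} => [|i] y zy /=; last first.
    exists (chain_of G i j y); rewrite diff_chain_of; apply/ffunP=> S.
    by move/ffunP/(_ S): zy; rewrite !ffunE raddfB /= => /subr0_eq.
  apply/chain_of_eq0 => s sE s0; have := proj1 (chain_of_eq0 _ _ _ _) zy s sE s0.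
  by rewrite (cards0_eq s0) /cobd big_set0 subr0.
- move=> h; have [z ez] := chain_of_onto (cycle_chain (repr h)).
  have cz : is_cycle i j z by apply/cycE; rewrite ez; apply: cycle_chainP.
  exists z => //; rewrite -[RHS]reprK; congr (\pi_(_)%qT _).
  by apply: val_inj; rewrite [LHS]valc.
Qed.

End Presentations.

(** * The star of the least vertex *)

Section Star.
Variable m : nat.
Implicit Types (t : {set 'I_m}) (s : {set edge m}) (a b : 'I_m) (f : edge m).
Implicit Types (E : {set edge m.+1}) (u : sqfree m.+1) (v : sqfree m).

Definition spoke a : edge m.+1 := (ord0, lift ord0 a).
Definition lift_edge f : edge m.+1 := (lift ord0 f.1, lift ord0 f.2).

(* The star vertex is the least one, so that the spokes precede all other edges. *)
Definition star t s : {set edge m.+1} := spoke @: t :|: lift_edge @: s.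

Lemma spoke_inj : injective spoke.
Proof. by move=> a b /eqP; rewrite xpair_eqE (inj_eq lift_inj) => /andP[_ /eqP]. Qed.

Lemma lift_edge_inj : injective lift_edge.
Proof.
by move=> [a b] [c d] /eqP; rewrite xpair_eqE !(inj_eq lift_inj) => /andP[/eqP/= -> /eqP/= ->].
Qed.

Lemma spoke_neq_lift_edge a f : spoke a == lift_edge f = false.
Proof. by rewrite xpair_eqE (negPf (neq_lift _ _)). Qed.

Lemma star_disjoint t s : [disjoint spoke @: t & lift_edge @: s].
Proof.
rewrite -setI_eq0; apply/eqP/setP=> e; rewrite !inE.
apply/andP=> -[/imsetP[a _ ->] /imsetP[f _ /eqP]].
by rewrite spoke_neq_lift_edge.
Qed.

Lemma mem_star_spoke a t s : (spoke a \in star t s) = (a \in t).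
Proof.
rewrite inE mem_imset; last exact: spoke_inj.
by apply/orP/idP => [[//|/imsetP[f _ /eqP]]|]; [rewrite spoke_neq_lift_edge|left].
Qed.

Lemma mem_star_lift_edge f t s : (lift_edge f \in star t s) = (f \in s).
Proof.
rewrite inE orbC mem_imset; last exact: lift_edge_inj.
by apply/orP/idP => [[//|/imsetP[a _ /eqP]]|]; [rewrite eq_sym spoke_neq_lift_edge|left].
Qed.

Lemma star_elim (P : edge m.+1 -> Prop) t s :
  (forall a, a \in t -> P (spoke a)) -> (forall f, f \in s -> P (lift_edge f)) ->
  forall e, e \in star t s -> P e.
Proof. by move=> Pt Ps e; rewrite inE => /orP[] /imsetP[x xt ->]; auto. Qed.

Lemma star_eq t s E :
  (forall e, e \in E -> (exists a, e = spoke a) \/ (exists f, e = lift_edge f)) ->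
  (forall a, (spoke a \in E) = (a \in t)) -> (forall f, (lift_edge f \in E) = (f \in s)) ->
  E = star t s.
Proof.
move=> EP Et Es; apply/setP=> e; apply/idP/idP => [eE|]; last first.
  by move: e; apply: star_elim => [a|f]; rewrite ?Et ?Es.
by have [[a ea]|[f ef]] := EP e eE; rewrite ?ea ?ef ?mem_star_spoke ?mem_star_lift_edge
   -?Et -?Es -?ea -?ef.
Qed.

Lemma star_sub_elim t s E : E \subset star t s ->
  forall e, e \in E -> (exists a, e = spoke a) \/ (exists f, e = lift_edge f).
Proof.
by move=> /subsetP sE e /sE; move: e; apply: star_elim => [a|f] _; [left; exists a|right; exists f].
Qed.

Lemma card_star t s : #|star t s| = (#|t| + #|s|)%N.
Proof.
rewrite cardsU disjoint_setI0 ?star_disjoint // cards0 subn0.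
by rewrite !card_imset //; [exact: lift_edge_inj | exact: spoke_inj].
Qed.

Lemma star_setD1_spoke t s a : star t s :\ spoke a = star (t :\ a) s.
Proof.
apply: star_eq => [|b|f]; first exact/star_sub_elim/subD1set.
  by rewrite 2!inE mem_star_spoke !inE (inj_eq spoke_inj).
by rewrite 2!inE mem_star_lift_edge eq_sym spoke_neq_lift_edge.
Qed.

Lemma star_setD1_lift_edge t s f : star t s :\ lift_edge f = star t (s :\ f).
Proof.
apply: star_eq => [|a|g]; first exact/star_sub_elim/subD1set.
  by rewrite 2!inE mem_star_spoke spoke_neq_lift_edge.
by rewrite 2!inE mem_star_lift_edge !inE (inj_eq lift_edge_inj).
Qed.

Lemma edge_lexlt_lift e f : edge_lexlt (lift_edge e) (lift_edge f) = edge_lexlt e f.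
Proof. by rewrite /edge_lexlt (inj_eq lift_inj) /= /bump !leq0n !add1n !ltnS. Qed.

Lemma nbelow_spoke t s a : nbelow (star t s) (spoke a) = #|[set b in t | (b < a)%N]|.
Proof.
have -> : #|[set b in t | (b < a)%N]| = #|star [set b in t | (b < a)%N] set0|.
  by rewrite card_star cards0 addn0.
congr #|pred_of_set _|; apply: star_eq => [|b|f].
- by apply: (@star_sub_elim t s); apply/subsetP=> e; rewrite inE => /andP[].
- by rewrite !inE -in_setU mem_star_spoke /edge_lexlt /= /bump !leq0n !add1n ltnS.
by rewrite !inE -in_setU andbC.
Qed.

Lemma nbelow_lift_edge t s f : nbelow (star t s) (lift_edge f) = (#|t| + nbelow s f)%N.
Proof.
rewrite -card_star; congr #|pred_of_set _|; apply: star_eq => [|a|e].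
- by apply: (@star_sub_elim t s); apply/subsetP=> e; rewrite inE => /andP[].
- by rewrite inE mem_star_spoke /edge_lexlt /= andbT.
by rewrite !inE -in_setU mem_star_lift_edge edge_lexlt_lift.
Qed.

(** This is the total differential of a double complex with rows indexed by [t]. A row differential
    carries the sign of [#|t|], because all spokes precede the lifted edges. *)
Lemma cobd_star (V : zmodType) (z : {set edge m.+1} -> V) t s :
  cobd z (star t s) =
  \sum_(a in t) z (star (t :\ a) s) *~ (-1) ^+ #|[set b in t | (b < a)%N]| +
  cobd (fun s => z (star t s)) s *~ (-1) ^+ #|t|.
Proof.
rewrite /cobd (eq_bigl [predU spoke @: t & lift_edge @: s]) => [|e]; last by rewrite !inE.
rewrite bigU ?star_disjoint //=; congr (_ + _).
  rewrite big_imset /=; last by move=> a b _ _ /spoke_inj.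
  by apply: eq_bigr => a _; rewrite star_setD1_spoke nbelow_spoke.
rewrite big_imset /=; last by move=> e f _ _ /lift_edge_inj.
rewrite mulrz_suml; apply: eq_bigr => f _.
by rewrite star_setD1_lift_edge nbelow_lift_edge exprD mulrC mulrzA.
Qed.

Lemma cobd_star0 (V : zmodType) (z : {set edge m.+1} -> V) s :
  cobd z (star set0 s) = cobd (fun s => z (star set0 s)) s.
Proof. by rewrite cobd_star big_set0 add0r cards0. Qed.

Lemma cobd_star1 (V : zmodType) (z : {set edge m.+1} -> V) a s :
  cobd z (star [set a] s) = z (star set0 s) - cobd (fun s => z (star [set a] s)) s.
Proof.
rewrite cobd_star big_set1 setDv cards1 expr1 mulrN1z; congr (_ - _).
rewrite (_ : [set b in _ | _] = set0) ?cards0 //; apply/setP=> b.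
by rewrite !inE; case: eqP => // ->; rewrite ltnn.
Qed.

Definition of_rows (V : Type) (g : {set 'I_m} -> {set edge m} -> V) E : V :=
  g [set a | spoke a \in E] [set f | lift_edge f \in E].

Lemma of_rowsE (V : Type) (g : {set 'I_m} -> {set edge m} -> V) t s :
  of_rows g (star t s) = g t s.
Proof.
by congr g; apply/setP=> x; rewrite inE ?mem_star_spoke ?mem_star_lift_edge.
Qed.

Lemma sub_complete_star E : E \subset edges (complete_graph m.+1) ->
  exists t s, s \subset edges (complete_graph m) /\ E = star t s.
Proof.
move=> /subsetP sE; exists [set a | spoke a \in E], [set f | lift_edge f \in E]; split.
  by apply/subsetP=> f; rewrite !inE => /sE; rewrite inE /= /bump !leq0n !add1n ltnS.
apply: star_eq => [[x y] eE|a|f]; rewrite ?inE //.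
have := sE _ eE; rewrite inE /=; case: (unliftP ord0 x) eE => [x' ->|->].
  by case: (unliftP ord0 y) => [y' -> _ _|->]; [right; exists (x', y')|].
by case: (unliftP ord0 y) => [y' -> _ _|->]; [left; exists y'|].
Qed.

Lemma star_sub_complete t s :
  (star t s \subset edges (complete_graph m.+1)) = (s \subset edges (complete_graph m)).
Proof.
apply/subsetP/subsetP => ss => [f fs|].
  have := ss (lift_edge f); rewrite mem_star_lift_edge fs => /(_ isT).
  by rewrite !inE /= /bump !leq0n !add1n ltnS.
apply: star_elim => [a _|f /ss]; rewrite !inE //.
Qed.

Lemma star_subset t t' s s' : t \subset t' -> s \subset s' -> star t s \subset star t' s'.
Proof. by move=> tt ss; apply: setUSS; apply: imsetS. Qed.

End Star.

(** * Splitting off the variable of the star vertex *)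

Section Restriction.
Variable m : nat.
Implicit Types (t : {set 'I_m}) (s : {set edge m}) (a b : 'I_m) (j : int).
Implicit Types (u : sqfree m.+1) (v : sqfree m).

(** [res0] and [res1] are the coefficients of 1 and x_0 when [u] is written as a polynomial in x_0
    over the other variables; see [sqfree_split]. *)
Definition res0 u : sqfree m := [ffun T : {set 'I_m} => u (lift ord0 @: T)].
Definition res1 u : sqfree m := [ffun T : {set 'I_m} => u (ord0 |: lift ord0 @: T)].
Definition embed v : sqfree m.+1 :=
  [ffun T : {set 'I_m.+1} => if ord0 \in T then 0 else v (lift ord0 @^-1: T)].

Lemma res0_is_zmod_morphism : zmod_morphism res0.
Proof. by move=> u v; apply/ffunP=> T; rewrite !ffunE. Qed.
HB.instance Definition _ := GRing.isZmodMorphism.Build _ _ res0 res0_is_zmod_morphism.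

Lemma res1_is_zmod_morphism : zmod_morphism res1.
Proof. by move=> u v; apply/ffunP=> T; rewrite !ffunE. Qed.
HB.instance Definition _ := GRing.isZmodMorphism.Build _ _ res1 res1_is_zmod_morphism.

Lemma embed_is_zmod_morphism : zmod_morphism embed.
Proof. by move=> u v; apply/ffunP=> T; rewrite !ffunE; case: ifP; rewrite ?subr0. Qed.
HB.instance Definition _ := GRing.isZmodMorphism.Build _ _ embed embed_is_zmod_morphism.

Lemma ord0_notin_lift (T : {set 'I_m}) : (ord0 \in lift ord0 @: T) = false.
Proof. by apply/imsetP=> -[a _ /eqP]; rewrite (negPf (neq_lift _ _)). Qed.

Lemma mem_lift (T : {set 'I_m}) a : (lift ord0 a \in lift ord0 @: T) = (a \in T).
Proof. exact/mem_imset/lift_inj. Qed.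

Lemma lift_preimK (T : {set 'I_m}) : lift ord0 @^-1: (lift ord0 @: T) = T.
Proof. by apply/setP=> a; rewrite inE mem_lift. Qed.

Lemma lift_imK (T : {set 'I_m.+1}) : ord0 \notin T -> lift ord0 @: (lift ord0 @^-1: T) = T.
Proof.
move=> T0; apply/setP=> x; case: (unliftP ord0 x) => [a ->|->]; first by rewrite mem_lift inE.
by rewrite ord0_notin_lift (negPf T0).
Qed.

Lemma lift_setD1 (T : {set 'I_m}) a : lift ord0 @: (T :\ a) = (lift ord0 @: T) :\ lift ord0 a.
Proof.
apply/setP=> x; case: (unliftP ord0 x) => [b ->|->].
  by rewrite !inE !mem_lift !inE (inj_eq lift_inj).
by rewrite !inE !ord0_notin_lift andbF.
Qed.

Lemma embedK v : res0 (embed v) = v.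
Proof. by apply/ffunP=> T; rewrite !ffunE ord0_notin_lift lift_preimK. Qed.

Lemma res1_embed v : res1 (embed v) = 0.
Proof. by apply/ffunP=> T; rewrite !ffunE setU11. Qed.

Lemma res0_mulX0 u : res0 (mulX ord0 u) = 0.
Proof. by apply/ffunP=> T; rewrite !ffunE ord0_notin_lift. Qed.

Lemma res1_mulX0 u : res1 (mulX ord0 u) = res0 u.
Proof. by apply/ffunP=> T; rewrite !ffunE setU11 setU1K // ord0_notin_lift. Qed.

Lemma res0_mulX a u : res0 (mulX (lift ord0 a) u) = mulX a (res0 u).
Proof. by apply/ffunP=> T; rewrite !ffunE mem_lift lift_setD1. Qed.

Lemma res1_mulX a u : res1 (mulX (lift ord0 a) u) = mulX a (res1 u).
Proof.
apply/ffunP=> T; rewrite !ffunE in_setU1 eq_sym (negPf (neq_lift _ _)) mem_lift /=.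
case: ifP => // _; congr (u _); rewrite lift_setD1 setDUl; congr (_ :|: _).
by apply/setP=> x; rewrite !inE; case: (x =P ord0) => [->|]; rewrite ?andbF ?neq_lift.
Qed.

Lemma embed_mulX a v : embed (mulX a v) = mulX (lift ord0 a) (embed v).
Proof.
apply/ffunP=> T; rewrite !ffunE !inE neq_lift /=; case: ifP => _; first by rewrite if_same.
case: ifP => // _; congr (v _); apply/setP=> b.
by rewrite !inE (inj_eq lift_inj).
Qed.

Lemma sqfree_split u : u = embed (res0 u) + mulX ord0 (embed (res1 u)).
Proof.
apply/ffunP=> T; rewrite !ffunE; case: ifP => T0; last by rewrite addr0 lift_imK ?T0.
rewrite setD11 add0r (_ : ord0 |: _ = T) //.
apply/setP=> x; case: (unliftP ord0 x) => [a ->|->]; last by rewrite setU11 T0.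
by rewrite in_setU1 mem_lift !inE eq_sym (negPf (neq_lift _ _)).
Qed.

Lemma part_res0 j u : part j (res0 u) = res0 (part j u).
Proof. by apply/ffunP=> T; rewrite !ffunE card_imset //; apply: lift_inj. Qed.

Lemma part_res1 j u : part (j - 1) (res1 u) = res1 (part j u).
Proof.
apply/ffunP=> T; rewrite !ffunE cardsU1 ord0_notin_lift card_imset; last exact: lift_inj.
by rewrite -[in RHS](inj_eq (addIr (- 1%:Z))) PoszD addrAC subrr add0r.
Qed.

(* The substitution x_0 := x_a. *)
Definition subst0 a u : sqfree m := res0 u + mulX a (res1 u).

Lemma subst0_is_zmod_morphism a : zmod_morphism (subst0 a).
Proof. by move=> u v; rewrite /subst0 !raddfB addrACA -opprD. Qed.
HB.instance Definition _ a :=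
  GRing.isZmodMorphism.Build _ _ (subst0 a) (subst0_is_zmod_morphism a).

Lemma subst0_embed a v : subst0 a (embed v) = v.
Proof. by rewrite /subst0 embedK res1_embed raddf0 addr0. Qed.

Lemma part_subst0 j a u : part j (subst0 a u) = subst0 a (part j u).
Proof. by rewrite /subst0 raddfD /= part_res0 part_mulX part_res1. Qed.

Lemma ideal_embed t s v : ideal s v -> ideal (star t s) (embed v).
Proof.
elim=> [|{}v w _ Qv _ Qw|f {}v fs]; rewrite ?raddf0 ?raddfB; first exact: Ideal0.
  exact: IdealB.
by rewrite /= !embed_mulX; apply: (@IdealX _ _ (lift_edge f)); rewrite mem_star_lift_edge.
Qed.

(** Without spokes no generator involves x_0, so membership splits along the coefficients of 1 and
    x_0; [ideal_star0] goes back. *)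
Lemma ideal_res s u : ideal (star set0 s) u -> ideal s (res0 u) /\ ideal s (res1 u).
Proof.
elim=> [|{}u v _ [? ?] _ [? ?]|e {}u es]; first by rewrite !raddf0; split; apply: Ideal0.
  by rewrite !raddfB; split; apply: IdealB.
move: e es; apply: star_elim => [a|f fs]; first by rewrite inE.
by rewrite !raddfB /= !res0_mulX !res1_mulX; split; apply: IdealX.
Qed.

Lemma ideal_star0 t s u : ideal s (res0 u) -> ideal s (res1 u) -> ideal (star t s) u.
Proof.
move=> s0 s1; rewrite [u]sqfree_split; apply: idealD; first exact: ideal_embed.
exact/ideal_mulX/ideal_embed.
Qed.

(** The generator x_0 - x_a is sent to 0 because x_a^2 = 0. With the converse [ideal_star1], the
    summand with the single spoke [a] becomes that of the smaller graph at [s]. *)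
Lemma ideal_subst0 a s u : ideal (star [set a] s) u -> ideal s (subst0 a u).
Proof.
elim=> [|{}u v _ ? _ ?|e {}u es]; first by rewrite raddf0; apply: Ideal0.
  by rewrite raddfB; apply: IdealB.
move: e es; apply: star_elim => [b /set1P->|f fs].
  rewrite raddfB /= /subst0 res0_mulX0 res1_mulX0 res0_mulX res1_mulX mulXX.
  by rewrite add0r addr0 subrr; apply: Ideal0.
rewrite raddfB /= /subst0 !res0_mulX !res1_mulX !(mulXC a) -!raddfD.
exact: IdealX.
Qed.

Lemma ideal_star1 a s u : ideal s (subst0 a u) -> ideal (star [set a] s) u.
Proof.
move=> sa; have -> : u = embed (subst0 a u) +
    (mulX ord0 (embed (res1 u)) - mulX (lift ord0 a) (embed (res1 u))).
  by rewrite raddfD /= embed_mulX addrCA addrK addrC -sqfree_split.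
apply: idealD; first exact: ideal_embed.
by apply: (@IdealX _ _ (spoke a)); rewrite mem_star_spoke set11.
Qed.
End Restriction.

(** * Acyclicity of the rows with several spokes *)

Section Null.
Variables (N : nat) (G : graph N).
Implicit Types z w : {set edge N} -> sqfree N.

Lemma null_ext i j z w : (forall s, z s = w s) -> null G i j z -> null G i j w.
Proof. by move=> zw z0 s sE si; rewrite -zw; apply: z0. Qed.

Lemma nullN i j z : null G i j z -> null G i j (fun s => - z s).
Proof. by move=> z0 s sE si; rewrite raddfN; apply/idealN/z0. Qed.

Lemma nullD i j z w : null G i j z -> null G i j w -> null G i j (fun s => z s + w s).
Proof. by move=> z0 w0 s sE si; rewrite raddfD; apply: idealD; [apply: z0|apply: w0]. Qed.

Lemma nullB i j z w : null G i j z -> null G i j w -> null G i j (fun s => z s - w s).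
Proof. by move=> z0 w0; apply/nullD/nullN. Qed.

Lemma null0 i j z : (forall s, z s = 0) -> null G i j z.
Proof. by move=> z0 s _ _; rewrite z0 raddf0; apply: Ideal0. Qed.

Lemma cycle_sub_cobd i j z w : is_cycle G i j z -> is_cycle G i j (fun s => z s - cobd w s).
Proof. by apply: null_ext => s; rewrite cobdB cobdK subr0. Qed.

End Null.

Section Acyclic.
Variable m : nat.
Implicit Types (t : {set 'I_m}) (s : {set edge m}) (a b : 'I_m) (j : int).
Implicit Types z w y : {set edge m.+1} -> sqfree m.+1.
Notation K := complete_graph.

Lemma null_star i j z :
  null (K m.+1) i j z <->
  forall t s, s \subset edges (K m) -> (#|t| + #|s|)%N = i ->
    ideal (star t s) (part j (z (star t s))).
Proof.
split=> [z0 t s sE ts|z0 E EK Ei].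
  by apply: z0; rewrite ?star_sub_complete ?card_star.
have [t [s [sE eE]]] := sub_complete_star EK.
by rewrite eE; apply: z0 => //; rewrite -card_star -eE.
Qed.

(** Both x_a and x_b are already congruent to x_0 through the spokes, so the edge between [a] and
    [b] contributes nothing new. *)
Lemma ideal_setU1_spokes t s a b u : a \in t -> b \in t ->
  ideal (star t ((a, b) |: s)) u -> ideal (star t s) u.
Proof.
move=> at_ bt; elim=> [|{}u v _ ? _ ?|e {}u es]; [exact: Ideal0|exact: IdealB|].
move: e es; apply: star_elim => [c ct|f]; first by apply: IdealX; rewrite mem_star_spoke.
case/setU1P=> [->|fs]; last by apply: IdealX; rewrite mem_star_lift_edge.
rewrite -(subrKA (mulX ord0 u)); apply: idealD.
  by rewrite -opprB; apply/idealN/(@IdealX _ _ (spoke a)); rewrite mem_star_spoke.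
by apply/(@IdealX _ _ (spoke b)); rewrite mem_star_spoke.
Qed.

(* The row of [t] with [#|t| >= 2] is contractible: it contains an edge both of
   whose ends are already joined through the star vertex. *)
Lemma star_acyclic (U : {set {set 'I_m}}) i j z :
  (forall t, t \in U -> (1 < #|t|)%N) ->
  (forall t t', t \in U -> t \subset t' -> t' \in U) ->
  is_cycle (K m.+1) i j z ->
  (forall t s, t \notin U -> s \subset edges (K m) -> (#|t| + #|s|)%N = i ->
     ideal (star t s) (part j (z (star t s)))) ->
  exists y, (forall t s, t \notin U -> y (star t s) = 0) /\
    null (K m.+1) i j (fun E => z E - cobd y E).
Proof.
elim: {U}_.+1 {-2}U (ltnSn #|U|) z => // n IH U; rewrite ltnS => Un z U2 Uup cz zU.
have [U0|[t1 t1U]] := set_0Vmem U.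
  exists (fun=> 0); split=> //; apply/null_star => t s sE ts.
  rewrite /cobd big1 ?subr0 => [|f _]; last by rewrite mul0rz.
  by apply: zU => //; rewrite U0 inE.
(* Removing a spoke from a smallest member of [U] leaves [U], so the row of [t0] receives spoke
   terms only from rows where [z] is already null. By minimality [U :\ t0] is again closed upwards,
   and the induction goes on with it. *)
pose t0 := [arg min_(t < t1 in U) #|t|].
have [t0U t0min] : t0 \in U /\ forall t, t \in U -> (#|t0| <= #|t|)%N.
  by rewrite /t0; case: arg_minnP.
have [a [b [at0 bt0 ab]]] : exists a b, [/\ a \in t0, b \in t0 & (a < b)%N].
  have /card_gt1P[a [b [at0 bt0]]] := U2 _ t0U.
  by rewrite neq_ltn => /orP[ab|ba]; [exists a, b|exists b, a].
pose f : edge m := (a, b).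
pose zr s := z (star t0 s).
(* The factor cancels the sign that [cobd_star] puts on the row of [t0]. *)
pose y1 := of_rows (fun t s => if t == t0 then htpy f zr s *~ (-1) ^+ #|t0| else 0).
have t0D1 c : c \in t0 -> t0 :\ c \notin U.
  move=> ct0; apply/negP=> /t0min; rewrite (cardsD1 c t0) ct0.
  by rewrite add1n ltnn.
have y1n t s : t != t0 -> y1 (star t s) = 0 by move=> /negPf tt0; rewrite /y1 of_rowsE tt0.
have Un' : (#|U :\ t0| < n)%N by move: Un; rewrite (cardsD1 t0 U) t0U.
have U2' t : t \in U :\ t0 -> (1 < #|t|)%N by case/setD1P=> _ /U2.
have Uup' t t' : t \in U :\ t0 -> t \subset t' -> t' \in U :\ t0.
  case/setD1P=> tt0 tU tt'; rewrite !inE (Uup t t') // andbT.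
  apply: contra_neq tt0 => et'; apply/eqP; rewrite eqEcard -{1}et' tt' /=.
  exact: t0min.
have zU' t s : t \notin U :\ t0 -> s \subset edges (K m) -> (#|t| + #|s|)%N = i ->
    ideal (star t s) (part j (z (star t s) - cobd y1 (star t s))).
  rewrite !inE negb_and negbK; have [->{t} _|tt0 /= tU] := eqVneq t t0 => sE ts.
    rewrite cobd_star big1 ?add0r => [|c ct0]; last first.
      rewrite y1n ?mul0rz //; apply: contraNneq (t0D1 c ct0) => ->; exact: t0U.
    have -> : cobd (fun s => y1 (star t0 s)) s *~ (-1) ^+ #|t0| = cobd (htpy f zr) s.
      rewrite /cobd mulrz_suml; apply: eq_bigr => g _.
      rewrite /y1 of_rowsE eqxx mulrzAC; congr (_ *~ _).
      by rewrite -mulrzA -expr2 sqrr_sign.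
    (* After the correction [htpy f (cobd zr) s] remains. The cycle condition at [f |: s] reduces it
       to the rows [t0 :\ c], where [z] is null, and [ideal_setU1_spokes] then discards [f] from the
       ideal. *)
    rewrite -[z (star t0 s)](htpyE f zr s) addrC addKr /htpy.
    case: ifP => [_|/negbT fs]; first by rewrite raddf0; apply: Ideal0.
    rewrite raddfMz /=; apply: idealMz; apply: (ideal_setU1_spokes at0 bt0).
    have fsE : f |: s \subset edges (K m) by rewrite subUset sub1set inE /= ab.
    rewrite /zr; have := cobd_star z t0 (f |: s); rewrite addrC => /(canLR (addrK _)).
    move/(congr1 (fun v => part j (v *~ (-1) ^+ #|t0|))).
    rewrite -mulrzA -expr2 sqrr_sign mulr1z => <-; rewrite raddfMz raddfB /=.
    apply/idealMz/IdealB.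
      apply: (proj1 (null_star i.+1 j (cobd z)) cz) => //.
      by rewrite cardsU1 fs add1n addnS ts.
    rewrite raddf_sum; apply: ideal_sum => c ct0; rewrite raddfMz; apply: idealMz.
    apply: (ideal_sub (star_subset (subD1set t0 c) (subxx (f |: s)))).
    apply: zU => //; first exact: t0D1.
    by rewrite cardsU1 fs -ts (cardsD1 c t0) ct0 add1n addnS.
  rewrite cobd_star big1 ?add0r => [|c ct]; last first.
    rewrite y1n ?mul0rz //; apply: contraNneq tU => et0.
    by apply: (Uup t0) => //; rewrite -et0 subD1set.
  rewrite /cobd big1 ?mul0rz ?subr0 => [|g _]; last by rewrite y1n // mul0rz.
  exact: zU.
have [y2 [y2U zy2]] := IH _ Un' _ U2' Uup' (cycle_sub_cobd y1 cz) zU'.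
exists (fun E => y1 E + y2 E); split=> [t s tU|].
  have tt0 : t != t0 by apply: contraNneq tU => ->.
  by rewrite y1n // y2U ?addr0 // inE (negPf tU) andbF.
by apply: null_ext zy2 => E; rewrite cobdD opprD addrA.
Qed.

(** [rowx] and [rowa] are coordinates on the quotient by the rows with several spokes. The remaining
    coordinate, [res0] of the spokeless row, is the one cancelled against the diagonal. *)
Definition rowx z s := res1 (z (star set0 s)).
Definition rowa a z s := subst0 a (z (star [set a] s)).

Lemma rowx_cobd z s : rowx (cobd z) s = cobd (rowx z) s.
Proof. by rewrite /rowx cobd_star0 -cobd_comp. Qed.

Lemma rowa_cobd a z s :
  rowa a (cobd z) s = res0 (z (star set0 s)) + mulX a (rowx z s) - cobd (rowa a z) s.
Proof. by rewrite /rowa cobd_star1 raddfB /= -cobd_comp. Qed.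

Lemma rowxB z w s : rowx (fun E => z E - w E) s = rowx z s - rowx w s.
Proof. by rewrite /rowx raddfB. Qed.

Lemma rowaB a z w s : rowa a (fun E => z E - w E) s = rowa a z s - rowa a w s.
Proof. by rewrite /rowa raddfB. Qed.

Lemma null_rowx i j z : null (K m.+1) i j z -> null (K m) i (j - 1) (rowx z).
Proof.
move=> /null_star z0 s sE si; rewrite part_res1.
by apply: (proj2 (ideal_res (z0 _ s sE _))); rewrite cards0.
Qed.

Lemma null_rowa a i j z : null (K m.+1) i.+1 j z -> null (K m) i j (rowa a z).
Proof.
move=> /null_star z0 s sE si; rewrite part_subst0; apply: ideal_subst0.
by apply: z0; rewrite // cards1 si.
Qed.

(** The rows with several spokes are acyclic, and so is the pair formed by [res0] of the spokeless
    row and the diagonal of the one-spoke rows. Neither contraction uses the coordinates required to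
    vanish on [y]. *)
Lemma kernel_acyclic (a0 : 'I_m) i j z :
  is_cycle (K m.+1) i j z -> null (K m) i (j - 1) (rowx z) ->
  (forall a s, s \subset edges (K m) -> #|s|.+1 = i ->
    ideal s (part j (rowa a z s - rowa a0 z s))) ->
  exists y, [/\ null (K m.+1) i j (fun E => z E - cobd y E),
    forall s, rowx y s = 0 & forall a s, rowa a y s = 0].
Proof.
move=> cz x0 aa0.
(* On the spokeless row, [embed (rowa a0 z s)] has a coboundary that meets every one-spoke row in
   this same value. Subtracting it leaves the differences from [a0], which are null by
   hypothesis. *)
pose y1 := of_rows (fun t s => if t == set0 then embed (rowa a0 z s) else 0).
have y10 s : y1 (star set0 s) = embed (rowa a0 z s) by rewrite /y1 of_rowsE eqxx.
have y11 a s : y1 (star [set a] s) = 0.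
  by rewrite /y1 of_rowsE; case: eqP => // /setP/(_ a); rewrite !inE eqxx.
pose z' E := z E - cobd y1 E.
have x1 s : rowx y1 s = 0 by rewrite /rowx y10 res1_embed.
have a1 a s : rowa a y1 s = 0 by rewrite /rowa y11 raddf0.
have xz' s : rowx z' s = rowx z s.
  by rewrite rowxB rowx_cobd /cobd big1 ?subr0 // => f _; rewrite x1 mul0rz.
have az' a s : rowa a z' s = rowa a z s - rowa a0 z s.
  rewrite rowaB rowa_cobd x1 raddf0 addr0 y10 embedK /cobd big1 ?subr0 // => f _.
  by rewrite a1 mul0rz.
have cz' : is_cycle (K m.+1) i j z' by apply: cycle_sub_cobd.
pose U := [set t : {set 'I_m} | (1 < #|t|)%N].
have z'U t s : t \notin U -> s \subset edges (K m) -> (#|t| + #|s|)%N = i ->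
    ideal (star t s) (part j (z' (star t s))).
  rewrite inE -leqNgt leq_eqVlt ltnS leqn0 => /orP[/cards1P[a ->]|].
    rewrite cards1 add1n => sE si; apply: ideal_star1; rewrite -part_subst0.
    by have := aa0 a s sE si; rewrite -az'.
  rewrite cards_eq0 => /eqP-> sE; rewrite cards0 add0n => si.
  have xs : ideal s (part (j - 1) (rowx z' s)) by rewrite xz'; apply: x0.
  apply: ideal_star0; last by rewrite -part_res1.
  (* The row of [a0] in [z'] is now zero, so the cycle condition there says that [res0] plus x_a0
     times [rowx] is null. Since [rowx] is null, so is [res0]. *)
  rewrite -part_res0; have := null_rowa a0 cz' sE si; rewrite rowa_cobd.
  rewrite [cobd (rowa a0 z') s]big1 => [|f _]; last by rewrite az' subrr mul0rz.
  rewrite subr0 raddfD /= => /IdealB/(_ (ideal_mulX a0 xs)).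
  by rewrite -part_mulX addrK.
have U2 t : t \in U -> (1 < #|t|)%N by rewrite inE.
have Uup t t' : t \in U -> t \subset t' -> t' \in U.
  by rewrite !inE => t1 /subset_leq_card; apply: leq_trans.
have [y2 [y20 zy2]] := star_acyclic U2 Uup cz' z'U.
exists (fun E => y1 E + y2 E); split=> [|s|a s].
- by apply: null_ext zy2 => E; rewrite /z' cobdD opprD addrA.
- by rewrite /rowx raddfD /= -/(rowx y1 s) x1 y20 ?raddf0 ?addr0 // inE cards0.
- by rewrite /rowa raddfD /= -/(rowa a y1 s) a1 y20 ?raddf0 ?addr0 // inE cards1.
Qed.

End Acyclic.

(** * The splitting *)

Section Homotopy.
Variable m : nat.
Implicit Types (s : {set edge m}) (a b c : 'I_m) (j : int).
Implicit Types z w : {set edge m} -> sqfree m.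
Notation K := (complete_graph m).

Definition edge_of a b : edge m := if (a < b)%N then (a, b) else (b, a).

Definition add_htpy a b z s : sqfree m :=
  mulX a (htpy (edge_of a b) z s) + mulX b (htpy (edge_of a b) z s).

Lemma add_htpyE a b z s :
  cobd (add_htpy a b z) s + add_htpy a b (cobd z) s = mulX a (z s) + mulX b (z s).
Proof.
have -> : cobd (add_htpy a b z) s =
    mulX a (cobd (htpy (edge_of a b) z) s) + mulX b (cobd (htpy (edge_of a b) z) s).
  by rewrite -!cobd_comp -cobdD.
by rewrite addrACA -!raddfD htpyE.
Qed.

(** Dropping an edge by [htpy] leads out of the ideals; the factor x_a + x_b leads back by
    [ideal_addX] and raises the degree by one. *)
Lemma null_add_htpy a b i j z : a != b ->
  null K i.+1 (j - 1) z -> null K i j (add_htpy a b z).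
Proof.
move=> ab z0 s sE si; rewrite /add_htpy /htpy.
case: ifP => [_|/negbT es]; first by rewrite !raddf0 addr0 raddf0; apply: Ideal0.
set v := _ *~ _; have : ideal (edge_of a b |: s) (part (j - 1) v).
  rewrite raddfMz; apply/idealMz/z0; last by rewrite cardsU1 es si.
  rewrite subUset sub1set sE andbT inE /edge_of.
  by case: (ltngtP a b) => //= /val_inj eab; rewrite eab eqxx in ab.
move/ideal_addX; rewrite -!part_mulX -raddfD /edge_of.
by case: ifP => //; rewrite addrC.
Qed.

(* With a third vertex [c], [x_a - x_b = (x_a + x_c) - (x_b + x_c)]. *)
Lemma sub_homotopy a b : (2 < m)%N ->
  exists h : ({set edge m} -> sqfree m) -> {set edge m} -> sqfree m,
    [/\ forall z w s, h (fun t => z t - w t) s = h z s - h w s,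
        forall z s, cobd (h z) s + h (cobd z) s = mulX a (z s) - mulX b (z s)
      & forall i j z, null K i.+1 (j - 1) z -> null K i j (h z)].
Proof.
move=> m3; have [c /andP[ca cb]] : exists c, (c != a) && (c != b).
  apply/existsP; apply: contraTT m3; rewrite negb_exists -leqNgt => /forallP ab.
  rewrite -[m]card_ord (leq_trans _ (card_size [:: a; b])) //.
  apply/subset_leq_card/subsetP=> c _; have := ab c.
  by rewrite negb_and !negbK !inE.
exists (fun z s => add_htpy a c z s - add_htpy b c z s); split.
- move=> z w s; rewrite /add_htpy !htpyB !raddfB /=.
  have linD (x x' y y' : sqfree m) : (x - x') + (y - y') = (x + y) - (x' + y').
    by rewrite addrACA -opprD.
  have linB (x x' y y' : sqfree m) : (x - x') - (y - y') = (x - y) - (x' - y').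
    by rewrite !opprB addrACA [RHS]addrACA (addrC (- x')).
  by rewrite !linD linB.
- move=> z s; rewrite cobdB addrACA -opprD !add_htpyE opprD addrACA subrr addr0 //.
- by move=> i j z z0; apply: nullB; apply: null_add_htpy => //; rewrite eq_sym.
Qed.

End Homotopy.

(** * Coordinates on the cone after cancelling the diagonal *)

Section Lifting.
Variable m : nat.
Implicit Types (s : {set edge m.+1}) (k : 'I_m).
Notation chains N := ({set edge N} -> sqfree N).
Implicit Types (v : chains m.+1) (w : 'I_m -> chains m.+1).

(** A section of [rowx] and [row_diff]: the row of the spoke [ord0], from which differences are
    measured, is zero. The sum has at most one term and is empty for all other nonempty [t]. *)
Definition lift_rows v w : chains m.+2 :=
  of_rows (fun t s => if t == set0 then mulX ord0 (embed (v s))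
                      else \sum_(k | t == [set lift ord0 k]) embed (w k s)).

Lemma rowx_lift_rows v w s : rowx (lift_rows v w) s = v s.
Proof. by rewrite /rowx /lift_rows of_rowsE eqxx res1_mulX0 embedK. Qed.

Lemma rowa0_lift_rows v w s : rowa ord0 (lift_rows v w) s = 0.
Proof.
rewrite /rowa /lift_rows of_rowsE -cards_eq0 cards1 big_pred0 ?raddf0 // => k.
by rewrite (inj_eq set1_inj) (negPf (neq_lift _ _)).
Qed.

Lemma rowa_lift_rows v w k s : rowa (lift ord0 k) (lift_rows v w) s = w k s.
Proof.
rewrite /rowa /lift_rows of_rowsE -cards_eq0 cards1 (big_pred1 k) ?subst0_embed // => k'.
by rewrite (inj_eq set1_inj) (inj_eq lift_inj) eq_sym.
Qed.

Definition row_diff k (z : chains m.+2) s : sqfree m.+1 :=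
  rowa (lift ord0 k) z s - rowa ord0 z s.

Lemma row_diffB k (z z' : chains m.+2) s :
  row_diff k (fun E => z E - z' E) s = row_diff k z s - row_diff k z' s.
Proof. by rewrite /row_diff !rowaB !opprD !opprK addrACA. Qed.

Lemma row_diff_lift_rows v w k s : row_diff k (lift_rows v w) s = w k s.
Proof. by rewrite /row_diff rowa_lift_rows rowa0_lift_rows subr0. Qed.

(** The [res0] term is common to all one-spoke rows and cancels. What remains is the differential of
    the cone of the maps x_a - x_b, with [b] the vertex [ord0] of the smaller graph. *)
Lemma row_diff_cobd k z s :
  row_diff k (cobd z) s =
  mulX (lift ord0 k) (rowx z s) - mulX ord0 (rowx z s) - cobd (row_diff k z) s.
Proof.
rewrite /row_diff !rowa_cobd cobdB !opprD !opprK addrACA; congr (_ + _).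
by rewrite addrACA subrr add0r.
Qed.

Lemma kernel_acyclic_diff i j (z : chains m.+2) :
  is_cycle (complete_graph m.+2) i j z ->
  null (complete_graph m.+1) i (j - 1) (rowx z) ->
  (forall k s, s \subset edges (complete_graph m.+1) -> #|s|.+1 = i ->
    ideal s (part j (row_diff k z s))) ->
  exists y, [/\ null (complete_graph m.+2) i j (fun E => z E - cobd y E),
    forall s, rowx y s = 0 & forall k s, row_diff k y s = 0].
Proof.
move=> cz x0 d0; have [a s sE si|y [zy yx ya]] := @kernel_acyclic m.+1 ord0 i j z cz x0.
  case: (unliftP ord0 a) => [k ->|->]; first exact: d0.
  by rewrite subrr raddf0; apply: Ideal0.
by exists y; split=> // k s; rewrite /row_diff !ya subrr.
Qed.

End Lifting.

(** * The recursion in positive degrees *)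

Section Recursion.
Variable m : nat.
Hypothesis m2 : (1 < m)%N.
Notation K1 := (complete_graph m.+1).
Notation K2 := (complete_graph m.+2).
Notation chains N := ({set edge N} -> sqfree N).

(** The bound [m2] gives the smaller complete graph at least three vertices, hence a common
    neighbour for the two ends of each difference. *)
Lemma star_homotopies :
  exists h : 'I_m -> chains m.+1 -> chains m.+1,
    [/\ forall k z w s, h k (fun t => z t - w t) s = h k z s - h k w s,
        forall k z s, cobd (h k z) s + h k (cobd z) s =
          mulX (lift ord0 k) (z s) - mulX ord0 (z s)
      & forall k i j z, null K1 i.+1 (j - 1) z -> null K1 i j (h k z)].
Proof.
have [h hP] := fin_all_exists (fun k : 'I_m => @sub_homotopy m.+1 (lift ord0 k) ord0 m2).
by exists h; split=> k; have [] := hP k.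
Qed.

Lemma homology_recursion i j :
  additive_iso (homology K2 i.+1 j)
    ({ffun 'I_m -> homology K1 i j} * homology K1 i.+1 (j - 1))%type.
Proof.
have [h [hB hE h0]] := star_homotopies.
have h_0 k w s : (forall t, w t = 0) -> h k w s = 0.
  move=> w0; rewrite (_ : w = fun t => w t - w t) ?hB ?subrr //.
  by apply/funext=> t; rewrite w0 subrr.
(* Subtracting the homotopy removes the connecting term of [row_diff_cobd]. So [d k] commutes with
   the differentials up to sign, and the cone splits. *)
pose d k (z : chains m.+2) s := row_diff k z s - h k (rowx z) s.
have dB k z w s : d k (fun E => z E - w E) s = d k z s - d k w s.
  rewrite /d row_diffB (_ : rowx _ = fun t => rowx z t - rowx w t); last first.
    by apply/funext=> t; rewrite rowxB.
  by rewrite hB !opprD !opprK addrACA.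
have d_cobd k z s : d k (cobd z) s = - cobd (d k z) s.
  rewrite /d row_diff_cobd -hE (_ : rowx (cobd z) = cobd (rowx z)); last first.
    by apply/funext=> t; rewrite rowx_cobd.
  by rewrite addrAC addrK -[LHS]opprB; congr (- _); exact/esym/cobdB.
have d0 k i' z : null K2 i'.+1 j z -> null K1 i' j (d k z).
  move=> z0; apply: nullB; last by apply/h0/null_rowx.
  by apply: nullB; apply: null_rowa.
pose Z1 := {ffun {set edge m.+1} -> sqfree m.+1}.
pose Z2 := {ffun {set edge m.+2} -> sqfree m.+2}.
pose phi (z : Z2) : ({ffun 'I_m -> Z1} * Z1)%type :=
  ([ffun k => [ffun s => d k z s]], [ffun s => rowx z s]).
have phiB : zmod_morphism phi.
  move=> z w; congr (_, _); last by apply/ffunP=> s; rewrite !ffunE /rowx !ffunE raddfB.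
  apply/ffunP=> k; apply/ffunP=> s; rewrite !ffunE -dB.
  by congr (d k _ s); apply/funext=> E; rewrite !ffunE.
pose phiA : {additive Z2 -> {ffun 'I_m -> Z1} * Z1} :=
  HB.pack phi (GRing.isZmodMorphism.Build _ _ phi phiB).
have phi1 z k : (phi z).1 k = d k z :> chains m.+1 by apply/funext=> s; rewrite !ffunE.
have phi2 z : (phi z).2 = rowx z :> chains m.+1 by apply/funext=> s; rewrite ffunE.
(* Adding back [h k w0] makes [psi] a section of the corrected coordinates. *)
pose psi w0 (w : 'I_m -> chains m.+1) : chains m.+2 :=
  lift_rows w0 (fun k s => w k s + h k w0 s).
have psix w0 w s : rowx (psi w0 w) s = w0 s by rewrite rowx_lift_rows.
have psid w0 w k s : d k (psi w0 w) s = w k s.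
  rewrite /d row_diff_lift_rows (_ : rowx _ = w0) ?addrK //.
  by apply/funext=> t; rewrite psix.
(* The kernel of the projection [phi] is acyclic, even when the coordinates vanish only modulo the
   ideals. *)
have acyclic i' z : is_cycle K2 i'.+1 j z -> null K1 i'.+1 (j - 1) (rowx z) ->
    (forall k, null K1 i' j (d k z)) ->
    exists y, [/\ null K2 i'.+1 j (fun E => z E - cobd y E),
      forall s, rowx y s = 0 & forall k s, d k y s = 0].
  move=> cz zx zd; have [k s sE [si]|y [zy yx yd]] := kernel_acyclic_diff cz zx.
    have := nullD (zd k) (h0 k _ _ _ zx); move/(_ s sE si).
    by rewrite /d subrK.
  by exists y; split=> // k s; rewrite /d yd h_0 ?subr0.
have cyc z : is_cycle K2 i.+1 j z -> is_cycle K1 i.+1 (j - 1) (rowx z) /\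
    forall k, is_cycle K1 i j (d k z).
  move=> cz; split=> [|k].
    by rewrite /is_cycle; apply: null_ext (null_rowx cz) => s; rewrite rowx_cobd.
  by rewrite /is_cycle; apply: null_ext (nullN (d0 k _ _ cz)) => s; rewrite d_cobd opprK.
apply: (@presents_iso _ _ _ _ _ _ _ _ phiA (homology_presents K2 i.+1 j)
  (presents_prod (presents_power m (homology_presents K1 i j))
                 (homology_presents K1 i.+1 (j - 1)))) => [z /cyc[cx cd]|z cz|[w w0] /= [cw cw0]].
- by split=> [k|]; rewrite ?phi1 ?phi2.
- split=> [[y zy]|[bd bx]].
    split=> [k|]; rewrite ?phi1 ?phi2.
      exists (fun s => - d k y s); apply: null_ext (d0 k _ _ zy) => s.
      by rewrite dB d_cobd cobdN.
    by exists (rowx y); apply: null_ext (null_rowx zy) => s; rewrite rowxB rowx_cobd.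
  have [y1 zy1] : is_bound K1 i.+1 (j - 1) (rowx z) by rewrite -phi2.
  have /fin_all_exists[y2 zy2] k : is_bound K1 i j (d k z) by rewrite -phi1; apply: bd.
  (* The minus sign compensates that [d k] anticommutes with [cobd]. Subtracting [cobd y] makes all
     coordinates null, and [acyclic] supplies the rest of the bounding chain. *)
  pose y := psi y1 (fun k s => - y2 k s).
  have [||k|y' [zy' _ _]] := acyclic i (fun E => z E - cobd y E).
  - exact: cycle_sub_cobd.
  - apply: null_ext zy1 => s; rewrite rowxB rowx_cobd; congr (_ - _).
    by apply: cobd_ext => f _; rewrite psix.
  - apply: null_ext (zy2 k) => s; rewrite dB d_cobd opprK -cobdN; congr (_ + _).
    by apply: cobd_ext => f _; rewrite psid.
  exists (fun E => y E + y' E); apply: null_ext zy' => E.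
  by rewrite cobdD opprD addrA.
(* The lift [z] need not be a cycle, but [cobd z] is a cycle with null coordinates, hence the
   coboundary of some [y] with zero coordinates up to null terms. Then [z - y] is a cycle over the
   given classes. *)
pose z := psi w0 (fun k => w k).
have [||k|y [zy yx yd]] := acyclic i.+1 (cobd z).
- by apply: null0 => E; apply: cobdK.
- apply: null_ext cw0 => s; rewrite rowx_cobd.
  by apply: cobd_ext => f _; rewrite psix.
- apply: null_ext (nullN (cw k)) => s; rewrite d_cobd; congr (- _).
  by apply: cobd_ext => f _; rewrite psid.
exists [ffun E => z E - y E].
  apply: null_ext zy => E; rewrite -cobdB.
  by apply: cobd_ext => f _; rewrite ffunE.
have fzy : [ffun E => z E - y E] = (fun E => z E - y E) :> chains m.+2.
  by apply/funext=> E; rewrite ffunE.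
split=> [k|]; exists (fun=> 0); apply: null0 => s; rewrite cobd0 // subr0 !ffunE fzy.
  by rewrite dB psid yd subr0 subrr.
by rewrite rowxB psix yx subr0 subrr.
Qed.
End Recursion.

(** * Extreme degrees *)

Lemma is_bound_null N (G : graph N) i j (z : {set edge N} -> sqfree N) :
  null G i j z -> is_bound G i j z.
Proof. by move=> z0; exists (fun=> 0); apply: null_ext z0 => s; rewrite cobd0 ?subr0. Qed.

(* For [m = 0] the range is [i >= 1], as H^0(K_1) is not zero. *)
Lemma cycle_bound m i j (z : {set edge m.+1} -> sqfree m.+1) :
  (0 < i)%N -> (m <= i)%N ->
  is_cycle (complete_graph m.+1) i j z -> is_bound (complete_graph m.+1) i j z.
Proof.
elim: m i j z => [|m IH] [//|i] j z _ mi cz.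
  apply: is_bound_null => s /subsetP sE si; have /card_gt0P[e es] : (0 < #|s|)%N by rewrite si.
  by have := sE e es; rewrite inE !ord1.
(* A bounding family for [rowx] is lifted and subtracted first. The row differences then become
   cycles one degree lower and are bounded in turn, without the homotopies. *)
have [|||y1 x1] := IH i.+1 (j - 1) (rowx z) => //; first exact: leqW.
  by rewrite /is_cycle; apply: null_ext (null_rowx cz) => s; rewrite rowx_cobd.
pose z1 E := z E - cobd (lift_rows y1 (fun _ _ => 0)) E.
have cz1 : is_cycle (complete_graph m.+2) i.+1 j z1 by apply: cycle_sub_cobd.
have xz1 : null (complete_graph m.+1) i.+1 (j - 1) (rowx z1).
  apply: null_ext x1 => s; rewrite rowxB rowx_cobd; congr (_ - _).
  by apply: cobd_ext => f _; rewrite rowx_lift_rows.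
have mulX0 a : null (complete_graph m.+1) i.+1 j (fun s => mulX a (rowx z1 s)).
  by move=> s sE si; rewrite part_mulX; apply/ideal_mulX/xz1.
have /fin_all_exists[y2 d2] (k : 'I_m) : is_bound (complete_graph m.+1) i j (row_diff k z1).
  (* An index [k] exists only for positive [m], and then [m <= i] gives [0 < i]. *)
  apply: IH => //; first by apply: leq_ltn_trans (leq0n k) _; apply: leq_trans (ltn_ord k) _.
  rewrite /is_cycle.
  have := nullB (nullB (mulX0 (lift ord0 k)) (mulX0 ord0))
    (nullB (null_rowa (lift ord0 k) cz1) (null_rowa ord0 cz1)).
  by apply: null_ext => s; rewrite -/(row_diff k (cobd z1) s) row_diff_cobd opprB addrC subrK.
pose z2 E := z1 E - cobd (lift_rows (fun=> 0) (fun k s => - y2 k s)) E.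
have [|||y3 [zy3 _ _]] := @kernel_acyclic_diff m i.+1 j z2.
- exact: cycle_sub_cobd.
- apply: null_ext xz1 => s; rewrite [RHS]rowxB rowx_cobd cobd0 ?subr0 // => t.
  by rewrite rowx_lift_rows.
- move=> k s sE [si]; have := d2 k s sE si; congr (ideal s (part j _)).
  have mul0 a : mulX a 0 = 0 :> sqfree m.+1 by exact: raddf0.
  rewrite [RHS]row_diffB row_diff_cobd rowx_lift_rows /= !mul0 subrr sub0r opprK.
  congr (_ + _); rewrite -cobdN; apply: cobd_ext => f _.
  by rewrite row_diff_lift_rows.
exists (fun E => lift_rows y1 (fun _ _ => 0) E +
  lift_rows (fun=> 0) (fun k s => - y2 k s) E + y3 E).
by apply: null_ext zy3 => E; rewrite !cobdD !opprD !addrA.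
Qed.

(** * Homology in degree zero *)

Section DegreeZero.
Variable N : nat.
Hypothesis N3 : (2 < N)%N.
Notation K := (complete_graph N).
Implicit Types z : {set edge N} -> sqfree N.

(** For a cycle, [u] lies in the ideal of every single edge, so (x_a + x_b) u = 0. Around a triangle
    this gives 2 x_a u = 0, hence x_a u = 0 for every a, and [u] is a multiple of the product of all
    variables. Conversely, that product lies in the ideal of every edge. *)
Lemma cycle0E j z :
  is_cycle K 0 j z <-> forall T, T != setT -> part j (z set0) T = 0.
Proof.
split=> [cz|z0 s sE s1]; last first.
  have /cards1P[f fs] : #|s| == 1%N by rewrite s1.
  move: sE; rewrite fs sub1set inE => f12.
  rewrite /cobd big_set1 setDv raddfMz; apply: idealMz.
  rewrite /= (sqfree_mono (part j (z set0))) (bigD1 setT) //= big1 ?addr0 => [|T nT]; last first.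
    by rewrite z0 ?mulr0z.
  apply: idealMz; have := ideal_mono [set f] setT; rewrite /mono_state ifN ?subr0 //.
  apply/negP=> /separatedP/(_ f.1 f.2 (in_setT _) (in_setT _)) e.
  by move: f12; rewrite e ?ltnn // connect1 // /adj -surjective_pairing set11.
set u := part j (z set0).
have u12 a b : a != b -> mulX a u + mulX b u = 0.
  wlog ab : a b / (a < b)%N => [IH nab|_].
    move: (nab); rewrite -val_eqE neq_ltn => /orP[/IH->//|/IH]; rewrite eq_sym addrC; exact.
  apply: ideal_set0; apply: (@ideal_addX _ _ (a, b)); rewrite setU0.
  have abE : [set (a, b)] \subset edges K by rewrite sub1set inE.
  have := cz _ abE (cards1 _); rewrite /cobd big_set1 setDv raddfMz /=.
  move/(idealMz ((-1) ^+ nbelow [set (a, b)] (a, b))).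
  by rewrite -mulrzA -expr2 sqrr_sign.
have u0 a : mulX a u = 0.
  have /card_gt1P[b [c [ba ca bc]]] : (1 < #|[set~ a]|)%N.
    by rewrite cardsC1 card_ord -ltnS prednK // (leq_trans _ N3).
  rewrite !inE ![_ == a]eq_sym in ba ca.
  have /(canRL (addKr _)) := u12 a b ba; rewrite addr0 => eb.
  have /(canRL (addKr _)) := u12 a c ca; rewrite addr0 => ec.
  apply/ffunP=> T; have /ffunP/(_ T) := u12 b c bc; rewrite eb ec -opprD !ffunE.
  by move/eqP; rewrite oppr_eq0 -mulr2n mulrn_eq0 => /eqP.
move=> T; rewrite -subTset => /subsetPn[a _ aT].
by have /ffunP/(_ (a |: T)) := u0 a; rewrite ffunE setU11 setU1K // [in RHS]ffunE.
Qed.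

Lemma is_bound0E j z : is_bound K 0 j z <-> part j (z set0) = 0.
Proof.
split=> [[y zy]|z0].
  apply: ideal_set0; have := zy set0 (sub0set _) (cards0 _).
  by rewrite /cobd big_set0 subr0.
apply: is_bound_null => s _ /cards0_eq ->; rewrite z0; exact: Ideal0.
Qed.

Lemma presents_int :
  presents (fun u : {ffun {set edge N} -> sqfree N} => is_cycle K 0 N%:Z u)
    (fun u => is_bound K 0 N%:Z u) int.
Proof.
pose top (z : {ffun {set edge N} -> sqfree N}) : int := part N%:Z (z set0) setT.
exists top; split=> [z w|z|h].
- have subE (u v : sqfree N) T : (u - v) T = u T - v T by rewrite !ffunE.
  have partE : part N%:Z ((z - w) set0) = part N%:Z (z set0) - part N%:Z (w set0).
    by rewrite -raddfB /= !ffunE.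
  rewrite !cycle0E /top partE subE => z0 w0; split=> // T nT.
  by rewrite subE z0 // w0 // subrr.
- rewrite cycle0E is_bound0E => z0; split=> [zT|z_0]; last by rewrite /top z_0 ffunE.
  by apply/ffunP=> T; rewrite [RHS]ffunE; have [->//|] := eqVneq T setT; apply: z0.
- exists [ffun s : {set edge N} => mono setT *~ h].
    by apply/cycle0E=> T nT; rewrite !ffunE ffunMzE ffunE (negPf nT) mul0rz if_same.
  by rewrite /top !ffunE ffunMzE ffunE eqxx cardsT card_ord eqxx intz.
Qed.

Lemma cycle0_bound j z : j != N%:Z -> is_cycle K 0 j z -> is_bound K 0 j z.
Proof.
move=> jN /cycle0E z0; apply/is_bound0E/ffunP=> T; rewrite [RHS]ffunE.
have [->|] := eqVneq T setT; last exact: z0.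
by rewrite ffunE cardsT card_ord eq_sym (negPf jN).
Qed.

End DegreeZero.

Lemma homology0 N (G : graph N) i j :
  (forall z : {set edge N} -> sqfree N, is_cycle G i j z -> is_bound G i j z) ->
  additive_iso (homology G i j) 'rV[int]_0.
Proof.
move=> cb; have [p [_ p0 pS]] := homology_presents G i j.
have h0 (h : homology G i j) : h = 0 by have [z cz <-] := pS h; apply/p0/cb.
exists (GRing.null_fun 'rV[int]_0); exists (fun=> 0) => [h|v]; first by rewrite [RHS]h0.
by rewrite [LHS]thinmx0 [RHS]thinmx0.
Qed.

Theorem theorem1p2 (n : nat) (hn : (4 <= n)%N) :
  [/\ graded_iso (chromatic_homology (complete_graph n) 0)
                 (graded_shift graded_Z n%:Z),
      forall i : nat, (1 <= i <= n - 2)%N ->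
        graded_iso (chromatic_homology (complete_graph n) i)
          (graded_sum
             (graded_power (chromatic_homology (complete_graph (n - 1)) (i - 1)) (n - 2))
             (graded_shift (chromatic_homology (complete_graph (n - 1)) i) 1%:Z))
    & forall i : nat, (n - 1 <= i)%N ->
        graded_iso (chromatic_homology (complete_graph n) i) graded_zero].
Proof.
split=> [j|i|i].
- have n3 : (2 < n)%N by exact: ltnW.
  rewrite /graded_shift /graded_Z; case: eqP => [/subr0_eq ->|/eqP jn].
    apply: (presents_iso (phi := idfun) (homology_presents _ _ _) (presents_int n3)) => // z cz.
    exists z => //; apply: is_bound_null => s _ _ /=.
    by rewrite subrr ffunE raddf0; apply: Ideal0.
  by apply: homology0 => z; apply: cycle0_bound => //; rewrite -subr_eq0.
(* Writing [n] as [m.+2] turns the bound [4 <= n] into the hypothesis [1 < m] of the recursion. *)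
- case: n hn i => [|[|m]] // m2 [|i] // _ j.
  by rewrite !subn1 !subn2; apply: homology_recursion.
- case: n hn i => // m m3 i; rewrite subn1 => mi j.
  have i_gt0 : (0 < i)%N by apply: leq_trans mi; rewrite -ltnS (leq_trans _ m3).
  by apply: homology0 => z; apply: cycle_bound.
Qed.
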